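(* There is an algorithm in the graph-access model which, given any directed graph $G$ on $n$ vertices and any vertex $t$, outputs an estimate of $\pi(t)$ that lies within a multiplicative factor $(1\pm 1/\log^{1/4} n)$ of $\pi(t)$ with probability at least $1-1/\log^{1/4} n$, and runs in expected time $$O\!\left((\log n)\max_{r\in[0,1]}\min\{T_r,\ r/\pi(t)\}\right).$$
   Context: Fix a constant $\alpha\in(0,1)$. An $\alpha$-discounted random walk from a vertex $s$: at each step it terminates with probability $\alpha$, and otherwise moves to a uniformly random out-neighbor of the current vertex; if the current vertex has no out-neighbors, the walk terminates. $\pi(s,t)$ is the probability that such a walk from $s$ terminates at $t$, and $\pi(t)=\sum_{v\in V}\pi(v,t)/n$. For $r\in[0,1]$, $V_r=\{v:\pi(v,t)\ge r\}$ and $T_r=\sum_{v\in V_r}(1+d_{\mathrm{in}}(v))$ with $d_{\mathrm{in}}$ the in-degree. Graph-access model: the algorithm knows $n$ and accesses the graph only via unit-time queries returning the in-degree or out-degree of a vertex, the $i$-th in-neighbor or $i$-th out-neighbor of a vertex, and a uniformly random vertex. Asymptotic notation is for $n\to\infty$ (n sufficiently large), $\alpha$ fixed. *)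

(* Defs.v *)
From HB Require Import structures.
From mathcomp Require Import all_boot all_order all_algebra.
From mathcomp Require Import all_classical all_reals all_analysis.
Set Implicit Arguments.
Unset Strict Implicit.
Unset Printing Implicit Defensive.
Import Order.TTheory GRing.Theory Num.Theory.
Import numFieldNormedType.Exports.
Local Open Scope ring_scope.

(* A directed graph on n vertices is a relation [e : rel 'I_n] ([e u v] is the
   edge u -> v): no parallel edges, self-loops allowed. *)

Definition outdeg n (e : rel 'I_n) (u : 'I_n) : nat := #|[set v | e u v]|.
Definition indeg n (e : rel 'I_n) (v : 'I_n) : nat := #|[set u | e u v]|.

(** * Discounted random walks and PageRank *)

(* Probability that the walk from s survives its first k steps and is then
   at v.  A vertex u without out-neighbours contributes nothing, so the walk
   moves nowhere from it. *)
Fixpoint walk_at (R : realType) (alpha : R) n (e : rel 'I_n) (s : 'I_n)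
    (k : nat) (v : 'I_n) : R :=
  if k is k'.+1 then
    \sum_(u | e u v)
      walk_at alpha e s k' u * ((1 - alpha) / (outdeg e u)%:R)
  else (s == v)%:R.

Definition stop_prob (R : realType) (alpha : R) n (e : rel 'I_n) (v : 'I_n) : R :=
  if outdeg e v == 0%N then 1 else alpha.

Definition ppr (R : realType) (alpha : R) n (e : rel 'I_n) (s t : 'I_n) : R :=
  limn (series (fun k => walk_at alpha e s k t * stop_prob alpha e t)).

Definition pagerank (R : realType) (alpha : R) n (e : rel 'I_n) (t : 'I_n) : R :=
  \sum_(v : 'I_n) ppr alpha e v t / n%:R.

Definition Vset (R : realType) (alpha : R) n (e : rel 'I_n) (t : 'I_n) (r : R) :
    {set 'I_n} := [set v | r <= ppr alpha e v t].

Definition Tsum (R : realType) (alpha : R) n (e : rel 'I_n) (t : 'I_n) (r : R) :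
    nat := (\sum_(v in Vset alpha e t r) (1 + indeg e v))%N.

(* The maximum over r in [0, 1]; it is attained because r |-> T_r is a
   nonincreasing left-continuous step function and r |-> r / pi(t) is
   increasing and continuous. *)
Definition max_min_cost (R : realType) (alpha : R) n (e : rel 'I_n) (t : 'I_n) : R :=
  sup [set Num.min (Tsum alpha e t r)%:R (r / pagerank alpha e t)
      | r in `[0, 1]%classic].

Definition log2 (R : realType) (n : nat) : R := ln n%:R / ln 2.

(* 1 / log^{1/4} n *)
Definition accuracy (R : realType) (n : nat) : R := (log2 R n `^ (4^-1))^-1.

(** * The graph-access model *)

(* The (arbitrary) orders in which in- and out-neighbours are listed. *)
Record adjacency n (e : rel 'I_n) := Adjacency {
  outs : 'I_n -> seq 'I_n;
  ins : 'I_n -> seq 'I_n;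
  outs_uniq : forall u, uniq (outs u);
  ins_uniq : forall v, uniq (ins v);
  mem_outs : forall u v, (v \in outs u) = e u v;
  mem_ins : forall u v, (u \in ins v) = e u v }.

(* The algorithm is a program for a unit-cost randomized RAM.  Word cells hold
   natural numbers below a bound W (polynomial in n, i.e. O(log n)-bit words);
   real cells hold exact reals with +, -, *, / and comparisons but no rounding
   to words.  There are word variables, word arrays, real variables and real
   arrays; variable and array names are fixed by the program, array indices are
   words.  The only real constants available to a program are alpha (preloaded)
   and those computed from words. *)

Inductive wexp :=
| WConst of nat
| WVar of nat
| WGet of nat & wexp             (* array name, index *)
| WAdd of wexp & wexp
| WSub of wexp & wexp            (* truncated *)
| WMul of wexp & wexp
| WDiv of wexp & wexp
| WMod of wexp & wexp.

Inductive rexp :=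
| RWord of wexp
| RVar of nat
| RGet of nat & wexp
| RAdd of rexp & rexp
| RSub of rexp & rexp
| RMul of rexp & rexp
| RDiv of rexp & rexp.

Inductive bexp :=
| BWle of wexp & wexp
| BWeq of wexp & wexp
| BRle of rexp & rexp
| BNot of bexp
| BAnd of bexp & bexp.

Inductive query :=
| QIndeg of wexp
| QOutdeg of wexp
| QIn of wexp & wexp             (* vertex, position counted from 0 *)
| QOut of wexp & wexp
| QRandVertex.

Inductive cmd :=
| Skip
| WSet of nat & wexp
| WPut of nat & wexp & wexp      (* array name, index, value *)
| RSet of nat & rexp
| RPut of nat & wexp & rexp
| Query of nat & query
| RandWord of nat & wexp         (* uniform word below a bound *)
| Flip of nat & rexp             (* 1 with the given probability, else 0 *)
| Seq of cmd & cmd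
| If of bexp & cmd & cmd
| While of bexp & cmd.

Record state (R : realType) := State {
  wvar : nat -> nat;
  warr : nat -> nat -> nat;
  rvar : nat -> R;
  rarr : nat -> nat -> R }.

Definition upd (A : Type) (f : nat -> A) (x : nat) (a : A) : nat -> A :=
  fun y => if y == x then a else f y.

Definition set_wvar (R : realType) (s : state R) x a : state R :=
  State (upd (wvar s) x a) (warr s) (rvar s) (rarr s).
Definition set_warr (R : realType) (s : state R) x i a : state R :=
  State (wvar s) (upd (warr s) x (upd (warr s x) i a)) (rvar s) (rarr s).
Definition set_rvar (R : realType) (s : state R) x a : state R :=
  State (wvar s) (warr s) (upd (rvar s) x a) (rarr s).
Definition set_rarr (R : realType) (s : state R) x i a : state R :=
  State (wvar s) (warr s) (rvar s) (upd (rarr s) x (upd (rarr s x) i a)).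

(* Every operation result is reduced modulo W. *)
Fixpoint weval (R : realType) (W : nat) (s : state R) (a : wexp) : nat :=
  match a with
  | WConst k => k %% W
  | WVar x => wvar s x
  | WGet x i => warr s x (weval W s i)
  | WAdd a b => (weval W s a + weval W s b) %% W
  | WSub a b => weval W s a - weval W s b
  | WMul a b => (weval W s a * weval W s b) %% W
  | WDiv a b => weval W s a %/ weval W s b
  | WMod a b => weval W s a %% weval W s b
  end%N.

Fixpoint reval (R : realType) (W : nat) (s : state R) (a : rexp) : R :=
  match a with
  | RWord a => (weval W s a)%:R
  | RVar x => rvar s x
  | RGet x i => rarr s x (weval W s i)
  | RAdd a b => reval W s a + reval W s b
  | RSub a b => reval W s a - reval W s b
  | RMul a b => reval W s a * reval W s b
  | RDiv a b => reval W s a / reval W s b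
  end.

Fixpoint beval (R : realType) (W : nat) (s : state R) (b : bexp) : bool :=
  match b with
  | BWle a b => (weval W s a <= weval W s b)%N
  | BWeq a b => weval W s a == weval W s b
  | BRle a b => reval W s a <= reval W s b
  | BNot b => ~~ beval W s b
  | BAnd b c => beval W s b && beval W s c
  end.

(* Finitely supported distributions are lists of (weight, value) pairs. *)
Definition uniform (R : realType) (m : nat) : seq (R * nat) :=
  [seq (m%:R^-1, j) | j <- iota 0 m].

Definition bernoulli01 (R : realType) (p : R) : seq (R * nat) :=
  let q := Num.max 0 (Num.min 1 p) in [:: (q, 1%N); (1 - q, 0%N)].

(* Malformed queries (not a vertex, position out of range) return 0. *)
Definition answer (R : realType) n (e : rel 'I_n) (A : adjacency e) (W : nat)
    (s : state R) (q : query) : seq (R * nat) :=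
  let at_vertex (f : 'I_n -> nat) (a : wexp) : seq (R * nat) :=
    [:: (1, oapp f 0%N (insub (weval W s a)))] in
  match q with
  | QIndeg a => at_vertex (fun v => size (ins A v)) a
  | QOutdeg a => at_vertex (fun v => size (outs A v)) a
  | QIn a i =>
      at_vertex (fun v => nth 0%N (map val (ins A v)) (weval W s i)) a
  | QOut a i =>
      at_vertex (fun v => nth 0%N (map val (outs A v)) (weval W s i)) a
  | QRandVertex => uniform R n
  end.

(* A configuration is the stack of commands left to execute and the memory;
   the computation has halted when the stack is empty. *)
Definition config (R : realType) : Type := (seq cmd * state R)%type.

Definition halted (R : realType) (c : config R) : bool := nilp c.1.

(* One unit of time.  A program has a fixed number of expressions of fixed
   size, so charging one unit for a command including the evaluation of its
   expressions changes running times by a constant factor only.  A halted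
   configuration has no successor. *)
Definition step (R : realType) n (e : rel 'I_n) (A : adjacency e) (W : nat)
    (c : config R) : seq (R * config R) :=
  let: (cs, s) := c in
  if cs is c1 :: K then
    let det K' s' : seq (R * config R) := [:: (1, (K', s'))] in
    let draw x (d : seq (R * nat)) : seq (R * config R) :=
      [seq (p.1, (K, set_wvar s x p.2)) | p <- d] in
    match c1 with
    | Skip => det K s
    | WSet x a => det K (set_wvar s x (weval W s a))
    | WPut x i a => det K (set_warr s x (weval W s i) (weval W s a))
    | RSet x a => det K (set_rvar s x (reval W s a))
    | RPut x i a => det K (set_rarr s x (weval W s i) (reval W s a))
    | Query x q => draw x (answer A W s q)
    | RandWord x a => draw x (uniform R (maxn 1 (weval W s a)))
    | Flip x p => draw x (bernoulli01 (reval W s p))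
    | Seq c2 c3 => det [:: c2, c3 & K] s
    | If b c2 c3 => det ((if beval W s b then c2 else c3) :: K) s
    | While b c2 => det (if beval W s b then [:: c2, c1 & K] else K) s
    end
  else [::].

(* Since halted configurations have no successor, [run A W k c] is the
   distribution of the configuration at time k restricted to the event that
   the computation has not halted before time k. *)
Fixpoint run (R : realType) n (e : rel 'I_n) (A : adjacency e) (W : nat)
    (k : nat) (c : config R) : seq (R * config R) :=
  if k is k'.+1 then
    [seq (p.1 * q.1, q.2) | p <- run A W k' c, q <- step A W p.2]
  else [:: (1, c)].

(* Inputs: word variable 0 holds n, word variable 1 holds t, real variable 0
   holds alpha; all other cells are 0. *)
Definition init_state (R : realType) (alpha : R) n (t : 'I_n) : state R :=
  State (upd (upd (fun=> 0%N) 0 n) 1 (val t)) (fun _ _ => 0%N)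
        (upd (fun=> 0) 0 alpha) (fun _ _ => 0).

(* The output is the final content of real variable 0. *)
Definition output (R : realType) (c : config R) : R := rvar c.2 0.

(* Words lie below (n + 1)^kappa. *)
Definition word_bound (n kappa : nat) : nat := (n.+1 ^ kappa)%N.

(* Probability that the program halts after exactly k steps with an output
   satisfying E. *)
Definition halt_prob (R : realType) (alpha : R) n (e : rel 'I_n)
    (A : adjacency e) (kappa : nat) (P : cmd) (t : 'I_n) (E : R -> bool)
    (k : nat) : R :=
  \sum_(p <- run A (word_bound n kappa) k ([:: P], init_state alpha t)
       | halted p.2 && E (output p.2)) p.1.

Definition output_prob (R : realType) (alpha : R) n (e : rel 'I_n)
    (A : adjacency e) (kappa : nat) (P : cmd) (t : 'I_n) (E : R -> bool) :
    \bar R :=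
  (\sum_(0 <= k <oo) (halt_prob alpha A kappa P t E k)%:E)%E.

Definition expected_time (R : realType) (alpha : R) n (e : rel 'I_n)
    (A : adjacency e) (kappa : nat) (P : cmd) (t : 'I_n) : \bar R :=
  if output_prob alpha A kappa P t xpredT == 1%E then
    (\sum_(0 <= k <oo) (k%:R * halt_prob alpha A kappa P t xpredT k)%:E)%E
  else +oo%E.

(* Main.v *)
Require Import Defs.
From mathcomp Require Import all_boot all_order all_algebra.
From mathcomp Require Import ring lra.
From mathcomp Require Import zify.
From mathcomp Require Import all_classical all_reals all_analysis.
Set Implicit Arguments.
Unset Strict Implicit.
Unset Printing Implicit Defensive.
Import Order.TTheory GRing.Theory Num.Theory.
Import numFieldNormedType.Exports.
Local Open Scope ring_scope.

(* Let x be a residue vector with ppr(s,t) = p(s) + sum_v visits(s,v) x(v) for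
   all s, initially p = 0 and x = stop_prob(t) at t.  If all residues are at
   most M, pushing simultaneously every residue above theta = alpha M / 2 keeps
   the identity and brings the bound down to (1 - alpha/2) M; since
   x(v) <= ppr(v,t), only vertices of V_theta are pushed, and the touched
   vertices are t and in-neighbours of V_theta, so a round costs O(T_theta).
   A walk from a random vertex ending at v yields the sample x(v) / stop_prob(v),
   whose mean is pi(t) - sum p / n and whose second moment is at most
   (M / alpha) pi(t).

   The algorithm keeps a budget N.  Each round it pushes if this costs at most N
   and doubles N otherwise, then draws N samples, and halts with their corrected
   average once the corrected sum exceeds K M, where K is of order log n.  With
   rho = N pi / (K M), which grows geometrically from round to round, Chebyshev
   bounds the probability of a bad output in a round by a multiple of
   rho / (K eps^2 (1 + rho)^2), which sums to O(1 / (K eps^2)), and the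
   probability of not halting by 4 / (alpha K rho) once rho >= 2.  Let X be the
   maximum of min(T_r, r / pi).  While rho < 2, a round costs O(N) with either
   N = O(X) or N = O(rho K X), and there are O(log n) rounds; afterwards the
   expected cost of the rounds decreases geometrically. *)

(** * Discounted walks and backward push *)

(** The samples never influence [N], [M] or the residues, so their sequence is deterministic and the
    only random event in a round is whether it halts, and with which sum. The halting rule cannot
    refer to the unknown PageRank; it compares the sum with [K M] because a sum of mean [N pi] and
    variance at most [N M pi / alpha] has squared relative deviation [1 / (alpha K rho)], which is
    small exactly when [rho] is about 1 and [K] is large. The sums over rounds are never formed.
    Each is replaced by a potential in [rho], namely [2 / (1 + rho)] for the error and
    [time_potential] for the time, which drops in a round by at least the contribution of that
    round. The comparison is an induction on the time horizon of [value], so nothing has to be known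
    about termination beforehand; halting with probability one is read off from the uniform time
    bound. The quantity [X] enters through one coincidence: the doubling rule bounds [N] by a
    multiple of [T_r], and the definition of [rho] makes [N] equal to [(2 K / alpha) rho] times
    [r / pi], both for the same [r], the push threshold [theta]. *)

Section Walks.
Local Open Scope classical_set_scope.
Local Open Scope ring_scope.
Variables (R : realType) (alpha : R) (n : nat) (e : rel 'I_n).
Hypothesis alpha01 : 0 < alpha < 1.

Let alpha_gt0 : 0 < alpha. Proof. by case/andP: alpha01. Qed.
Let alpha_lt1 : alpha < 1. Proof. by case/andP: alpha01. Qed.
Let beta_ge0 : 0 <= 1 - alpha. Proof. by rewrite subr_ge0 ltW. Qed.

Definition hop (u : 'I_n) : R := (1 - alpha) / (outdeg e u)%:R.

Lemma hop_ge0 u : 0 <= hop u.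
Proof. by rewrite divr_ge0. Qed.

Lemma stop_prob_ge u : alpha <= stop_prob alpha e u.
Proof. by rewrite /stop_prob; case: ifP => // _; rewrite ltW. Qed.

Lemma stop_prob_gt0 u : 0 < stop_prob alpha e u.
Proof. exact: lt_le_trans alpha_gt0 (stop_prob_ge u). Qed.

Lemma stop_prob_le1 u : stop_prob alpha e u <= 1.
Proof. by rewrite /stop_prob; case: ifP => // _; rewrite ltW. Qed.

Lemma sum_hop u : \sum_(v | e u v) hop u = 1 - stop_prob alpha e u.
Proof.
rewrite sumr_const /hop /stop_prob.
have -> : #|[pred v | e u v]| = outdeg e u by rewrite /outdeg cardsE.
case: ifPn => [/eqP ->|d0]; first by rewrite mulr0n subrr.
by rewrite -(mulr_natr (_ / _)) divfK // pnatr_eq0.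
Qed.

Lemma walk_at_ge0 s k v : 0 <= walk_at alpha e s k v.
Proof.
elim: k v => [|k IH] v /=; first exact: ler0n.
by apply: sumr_ge0 => u _; rewrite mulr_ge0 // hop_ge0.
Qed.

Lemma walk_at_massS s k :
  \sum_v walk_at alpha e s k.+1 v =
  \sum_u walk_at alpha e s k u * (1 - stop_prob alpha e u).
Proof.
rewrite /= (exchange_big_dep xpredT) //=.
by apply: eq_bigr => u _; rewrite -mulr_sumr sum_hop.
Qed.

Lemma walk_at_mass0 s : \sum_v walk_at alpha e s 0 v = 1.
Proof.
rewrite (bigD1 s) //= eqxx big1 ?addr0 // => v.
by rewrite eq_sym => /negPf ->.
Qed.

Lemma walk_at_mass_le s k : \sum_v walk_at alpha e s k v <= (1 - alpha) ^+ k.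
Proof.
elim: k => [|k IH]; first by rewrite walk_at_mass0.
rewrite walk_at_massS exprS mulrC.
apply: (@le_trans _ _ ((\sum_u walk_at alpha e s k u) * (1 - alpha))).
  rewrite mulr_suml; apply: ler_sum => u _.
  by rewrite ler_wpM2l ?walk_at_ge0 // lerD2l lerN2 stop_prob_ge.
by rewrite ler_wpM2r.
Qed.

Lemma walk_at_le s k v : walk_at alpha e s k v <= (1 - alpha) ^+ k.
Proof.
apply: le_trans (walk_at_mass_le s k).
by rewrite (bigD1 v) //= lerDl sumr_ge0 // => u _; exact: walk_at_ge0.
Qed.

(** [walk_at] unfolds the last step, whereas a simulated walk is analysed from its first step;
    exchanging two finite sums turns one recurrence into the other. *)
Lemma walk_at_first s k v :
  walk_at alpha e s k.+1 v = \sum_(w | e s w) hop s * walk_at alpha e w k v.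
Proof.
elim: k v => [|k IH] v.
  rewrite /= (big_mkcond (fun u => e u v)) (big_mkcond (e s)) /=.
  rewrite (bigD1 s) //= big1 ?addr0; last first.
    by move=> u /negPf us; rewrite eq_sym us mul0r if_same.
  rewrite (bigD1 v) //= big1 ?addr0; last first.
    by move=> u /negPf us; rewrite us mulr0 if_same.
  by rewrite !eqxx mul1r mulr1.
rewrite [LHS]/=.
transitivity (\sum_(u | e u v) \sum_(w | e s w)
   hop s * (walk_at alpha e w k u * hop u)).
  apply: eq_bigr => u _; rewrite -/(walk_at alpha e s k.+1 u) IH mulr_suml.
  by apply: eq_bigr => w _; rewrite mulrA.
rewrite exchange_big /=; apply: eq_bigr => w _; by rewrite mulr_sumr.
Qed.

(** The Green function of the killed walk. It leaves out the stopping probability of the end vertex,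
    so residues can be moved linearly between vertices that stop with different probabilities. *)
Definition visits (s v : 'I_n) : R := limn (series (walk_at alpha e s ^~ v)).

Lemma cvg_visits s v :
  series (walk_at alpha e s ^~ v) @ \oo --> visits s v.
Proof.
have /cvgP h : cvgn (series (walk_at alpha e s ^~ v)).
  apply: (@series_le_cvg _ _ (geometric 1 (1 - alpha))).
  - by move=> k; exact: walk_at_ge0.
  - by move=> k; rewrite /= mul1r exprn_ge0.
  - by move=> k; rewrite /= mul1r walk_at_le.
  - by apply: is_cvg_geometric_series; rewrite ger0_norm // ltrBlDr ltrDl.
exact: h.
Qed.

Lemma visits_ge0 s v : 0 <= visits s v.
Proof.
apply: limr_ge; first exact: cvgP (@cvg_visits s v).
by near=> k; apply: sumr_ge0 => i _; exact: walk_at_ge0.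
Unshelve. all: by end_near.
Qed.

Lemma visits_ge1 v : 1 <= visits v v.
Proof.
apply: limr_ge; first exact: cvgP (@cvg_visits v v).
near=> k; have k0 : (0 < k)%N by near: k; exists 1%N.
rewrite /series /= big_ltn //= eqxx lerDl.
by apply: sumr_ge0 => i _; exact: walk_at_ge0.
Unshelve. all: by end_near.
Qed.

Lemma visits_last s v :
  visits s v = (s == v)%:R + \sum_(u | e u v) visits s u * hop u.
Proof.
have h1 : (fun m => series (walk_at alpha e s ^~ v) m.+1) @ \oo --> visits s v.
  by rewrite cvg_shiftS; exact: cvg_visits.
apply: (cvg_unique _ h1) => //.
have -> : (fun m => series (walk_at alpha e s ^~ v) m.+1) =
   (fun m => (s == v)%:R + \sum_(u | e u v) series (walk_at alpha e s ^~ u) m * hop u).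
  apply/funext => m; rewrite /series /= big_nat_recl //=; congr (_ + _).
  rewrite exchange_big /=; apply: eq_bigr => u _; by rewrite mulr_suml.
apply: cvgD; first exact: cvg_cst.
apply: cvg_big => [|u _]; first exact: add_continuous.
by apply: cvgM; [exact: cvg_visits|exact: cvg_cst].
Qed.

Lemma visits_first s v :
  visits s v = (s == v)%:R + \sum_(w | e s w) hop s * visits w v.
Proof.
have h1 : (fun m => series (walk_at alpha e s ^~ v) m.+1) @ \oo --> visits s v.
  by rewrite cvg_shiftS; exact: cvg_visits.
apply: (cvg_unique _ h1) => //.
have -> : (fun m => series (walk_at alpha e s ^~ v) m.+1) =
   (fun m => (s == v)%:R + \sum_(w | e s w) hop s * series (walk_at alpha e w ^~ v) m).
  apply/funext => m; rewrite /series /= big_nat_recl //=; congr (_ + _).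
  rewrite (eq_bigr (fun k => \sum_(w | e s w) hop s * walk_at alpha e w k v)); last first.
    by move=> k _; rewrite -walk_at_first.
  rewrite exchange_big /=; apply: eq_bigr => u _; by rewrite mulr_sumr.
apply: cvgD; first exact: cvg_cst.
apply: cvg_big => [|u _]; first exact: add_continuous.
by apply: cvgM; [exact: cvg_cst|exact: cvg_visits].
Qed.

Lemma pprE s t : ppr alpha e s t = visits s t * stop_prob alpha e t.
Proof.
rewrite /ppr; apply/cvg_lim => //.
have -> : series (fun k => walk_at alpha e s k t * stop_prob alpha e t) =
   (fun m => series (walk_at alpha e s ^~ t) m * stop_prob alpha e t).
  by apply/funext => m; rewrite /series /= mulr_suml.
by apply: cvgM; [exact: cvg_visits|exact: cvg_cst].
Qed.

Lemma ppr_ge0 s t : 0 <= ppr alpha e s t.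
Proof. by rewrite pprE mulr_ge0 ?visits_ge0 // ltW // stop_prob_gt0. Qed.

Lemma ppr_first s t :
  ppr alpha e s t =
  stop_prob alpha e t * (s == t)%:R + \sum_(w | e s w) hop s * ppr alpha e w t.
Proof.
rewrite pprE visits_first mulrDl mulrC; congr (_ + _).
rewrite mulr_suml; apply: eq_bigr => w _; by rewrite pprE mulrA.
Qed.

(** The mass stopped before time [m] telescopes to [1 - W m], and the surviving mass [W m] is at
    most [(1 - alpha) ^+ m]. *)
Lemma sum_ppr s : \sum_v ppr alpha e s v = 1.
Proof.
pose W k := \sum_v walk_at alpha e s k v.
have W0 : (fun m => 1 - W m) @ \oo --> (1 : R).
  rewrite -[X in _ --> X]subr0; apply: cvgB; first exact: cvg_cst.
  apply: (@squeeze_cvgr _ _ _ _ (fun=> 0) (geometric 1 (1 - alpha))).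
  - near=> m; rewrite /W /= mul1r walk_at_mass_le andbT.
    by apply: sumr_ge0 => v _; exact: walk_at_ge0.
  - exact: cvg_cst.
  - by apply: cvg_geometric; rewrite ger0_norm // ltrBlDr ltrDl.
apply: (cvg_unique _ _ W0) => //.
have -> : (fun m => 1 - W m) =
    (fun m => \sum_v series (walk_at alpha e s ^~ v) m * stop_prob alpha e v).
  apply/funext => m; elim: m => [|m IH].
    by rewrite /W walk_at_mass0 subrr big1 // => v _; rewrite /series /= big_geq // mul0r.
  under eq_bigr => v _ do rewrite seriesSr mulrDl.
  rewrite big_split /= -IH /W walk_at_massS.
  under [X in 1 - X = _]eq_bigr => u _ do rewrite mulrBr mulr1.
  by rewrite sumrB opprB addrA addrAC.
have -> : (\sum_v ppr alpha e s v) = \sum_v visits s v * stop_prob alpha e v.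
  by apply: eq_bigr => v _; exact: pprE.
apply: cvg_big => [|u _]; first exact: add_continuous.
by apply: cvgM; [exact: cvg_visits|exact: cvg_cst].
Unshelve. all: by end_near.
Qed.

Lemma ppr_le1 s t : ppr alpha e s t <= 1.
Proof.
rewrite -(sum_ppr s) (bigD1 t) //= lerDl sumr_ge0 // => v _; exact: ppr_ge0.
Qed.

Lemma ppr_self_ge t : alpha <= ppr alpha e t t.
Proof.
rewrite pprE -[leLHS]mul1r ler_pM ?visits_ge1 ?stop_prob_ge //; exact: ltW.
Qed.

Lemma pagerankE t : pagerank alpha e t = (\sum_s ppr alpha e s t) / n%:R.
Proof. by rewrite /pagerank mulr_suml. Qed.

Lemma pagerank_ge t : alpha / n%:R <= pagerank alpha e t.
Proof.
rewrite pagerankE ler_wpM2r ?invr_ge0 // (bigD1 t) //=.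
apply: le_trans (ppr_self_ge t) _.
by rewrite lerDl sumr_ge0 // => v _; exact: ppr_ge0.
Qed.

Lemma pagerank_gt0 t : 0 < pagerank alpha e t.
Proof.
have n0 : (0 < n)%N by case: n t => [[]|].
by apply: lt_le_trans (pagerank_ge t); rewrite divr_gt0 // ltr0n.
Qed.

Lemma pagerank_le1 t : pagerank alpha e t <= 1.
Proof.
have n0 : (0 < n)%N by case: n t => [[]|].
rewrite pagerankE ler_pdivrMr ?ltr0n // mul1r.
have -> : n%:R = \sum_(s < n) (1 : R) by rewrite sumr_const card_ord.
apply: ler_sum => s _; exact: ppr_le1.
Qed.

(* The residue pushed out of [w] comes back through the last-step recurrence of
   [visits]. *)
Lemma push_identity t (p x a : 'I_n -> R) :
  (forall s, ppr alpha e s t = p s + \sum_v visits s v * x v) ->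
  forall s, ppr alpha e s t = (p s + a s) + \sum_v visits s v *
    (x v - a v + hop v * \sum_(w | e v w) a w).
Proof.
move=> inv s; rewrite inv -addrA; congr (_ + _).
have -> : \sum_v visits s v * (x v - a v + hop v * \sum_(w | e v w) a w) =
  \sum_v visits s v * x v - \sum_v visits s v * a v
   + \sum_v visits s v * (hop v * \sum_(w | e v w) a w).
  rewrite -sumrB -big_split /=; apply: eq_bigr => v _; ring.
have -> : \sum_v visits s v * (hop v * \sum_(w | e v w) a w) =
   \sum_w (\sum_(v | e v w) visits s v * hop v) * a w.
  under eq_bigr => v _ do rewrite mulrA mulr_sumr.
  rewrite (exchange_big_dep xpredT) //=.
  by apply: eq_bigr => w _; rewrite mulr_suml.
have -> : \sum_v visits s v * a v =
   a s + \sum_w (\sum_(v | e v w) visits s v * hop v) * a w.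
  under eq_bigr => v _ do rewrite visits_last mulrDl.
  rewrite big_split /=; congr (_ + _).
  rewrite (bigD1 s) //= eqxx mul1r big1 ?addr0 // => v.
  by rewrite eq_sym => /negPf ->; rewrite mul0r.
ring.
Qed.

(** A vertex keeps at most [alpha * M / 2], since anything larger is pushed out entirely, and
    receives at most [(1 - alpha) * M] through its out-edges. *)
Lemma push_contracts (M : R) (x : 'I_n -> R) :
  (forall v, 0 <= x v <= M) ->
  let a v := if alpha * M / 2 <= x v then x v else 0 in
  forall v, 0 <= x v - a v + hop v * \sum_(w | e v w) a w <= (1 - alpha / 2) * M.
Proof.
move=> xM a v.
have a0 w : 0 <= a w by rewrite /a; case: ifP => // _; case/andP: (xM w).
have M0 : 0 <= M by case/andP: (xM v) => ? ?; lra.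
have aM w : a w <= M by rewrite /a; case: ifP => // _; case/andP: (xM w).
have h0 : 0 <= hop v * \sum_(w | e v w) a w.
  by rewrite mulr_ge0 ?hop_ge0 // sumr_ge0.
have h1 : hop v * \sum_(w | e v w) a w <= (1 - alpha) * M.
  apply: (@le_trans _ _ ((1 - stop_prob alpha e v) * M)).
    rewrite -sum_hop mulr_suml mulr_sumr; apply: ler_sum => w _.
    by rewrite ler_wpM2l ?hop_ge0.
  by rewrite ler_wpM2r // lerD2l lerN2 stop_prob_ge.
have h2 : 0 <= x v - a v <= alpha * M / 2.
  rewrite /a; case: ifPn => [_|]; last by rewrite -ltNge subr0 => /ltW ->; case/andP: (xM v) => ->.
  by rewrite subrr lexx /= divr_ge0 // mulr_ge0 // ltW.
case/andP: h2 => h2 h3; apply/andP; split; lra.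
Qed.

Lemma residue_le_ppr t (p x : 'I_n -> R) :
  (forall v, 0 <= p v) -> (forall v, 0 <= x v) ->
  (forall s, ppr alpha e s t = p s + \sum_v visits s v * x v) ->
  forall v, x v <= ppr alpha e v t.
Proof.
move=> p0 x0 inv v; rewrite inv (bigD1 v) //=.
have h : 0 <= \sum_(i | i != v) visits v i * x i.
  by apply: sumr_ge0 => i _; rewrite mulr_ge0 ?visits_ge0.
have := visits_ge1 v; have := p0 v; have := x0 v.
move=> a b c; have : x v <= visits v v * x v by rewrite ler_peMl.
lra.
Qed.

(** By [pagerankE] this is the PageRank of [u], read here as the distribution of the end of a walk
    with uniform start. *)
Definition endpoint (u : 'I_n) : R := (\sum_s ppr alpha e s u) / n%:R.

Lemma endpoint_ge0 u : 0 <= endpoint u.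
Proof. by rewrite divr_ge0 // sumr_ge0 // => s _; exact: ppr_ge0. Qed.

Lemma sum_endpoint (t : 'I_n) : \sum_u endpoint u = 1.
Proof.
have n0 : (0 < n)%N by case: n t => [[]|].
rewrite -mulr_suml exchange_big /=.
rewrite (eq_bigr (fun=> 1)) => [|s _]; last exact: sum_ppr.
by rewrite sumr_const card_ord divff // pnatr_eq0 -lt0n.
Qed.

(** Dividing by [stop_prob] turns the probability of ending at [u] into the average over [s] of
    [visits s u], which is the weight of [x u] in the push identity. *)
Lemma mean_sample t (p x : 'I_n -> R) :
  (forall s, ppr alpha e s t = p s + \sum_v visits s v * x v) ->
  \sum_u endpoint u * (x u / stop_prob alpha e u) =
  pagerank alpha e t - (\sum_s p s) / n%:R.
Proof.
move=> inv; rewrite pagerankE -mulrBl -sumrB.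
have -> : \sum_i (ppr alpha e i t - p i) = \sum_i \sum_v visits i v * x v.
  by apply: eq_bigr => i _; rewrite inv addrC addKr.
rewrite exchange_big /= mulr_suml; apply: eq_bigr => u _.
have sp := lt0r_neq0 (stop_prob_gt0 u).
have -> : endpoint u = (\sum_s visits s u) * stop_prob alpha e u / n%:R.
  by rewrite /endpoint [X in _ = X / _]mulr_suml; congr (_ / _); apply: eq_bigr => s _; rewrite pprE.
rewrite -mulr_suml.
set A := (\sum_ _ _); set N := n%:R^-1; move: sp; set st := stop_prob _ _ _ => sp.
by rewrite mulrAC; congr (_ * _); field.
Qed.

End Walks.

(** * Expectations over runs of a program *)

Section Semantics.
Variables (R : realType) (n : nat) (e : rel 'I_n) (A : adjacency e) (W : nat).
Hypothesis n_gt0 : (0 < n)%N.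

Implicit Types (c : config R) (E : R -> bool) (m k : nat).

Lemma sum_uniform (d : nat) (F : nat -> R) :
  \sum_(p <- uniform R d) p.1 * F p.2 = d%:R^-1 * \sum_(j < d) F j.
Proof.
rewrite /uniform big_map mulr_sumr -(big_mkord xpredT (fun j => d%:R^-1 * F j)).
by rewrite /index_iota subn0.
Qed.

Definition proper_dist (T : Type) (d : seq (R * T)) : Prop :=
  all (fun p => 0 <= p.1) d /\ \sum_(p <- d) p.1 = 1.

Lemma proper_dist1 (T : Type) (x : T) : proper_dist [:: (1 : R, x)].
Proof. by split; rewrite /= ?ler01 // big_seq1. Qed.

Lemma proper_uniform d : (0 < d)%N -> proper_dist (uniform R d).
Proof.
move=> d0; split.
  by apply/allP => p /mapP[j _ ->] /=; rewrite invr_ge0.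
have := sum_uniform d (fun=> 1); under eq_bigr do rewrite mulr1.
by move=> ->; rewrite sumr_const card_ord mulVf // pnatr_eq0 -lt0n.
Qed.

Lemma proper_bernoulli (p : R) : proper_dist (bernoulli01 p).
Proof.
rewrite /bernoulli01; set q := Num.max _ _.
have q0 : 0 <= q by rewrite /q le_max lexx.
have q1 : q <= 1 by rewrite /q ge_max ler01 /= ge_min lexx.
split; rewrite /= ?q0 ?subr_ge0 ?q1 // !big_cons big_nil /=; ring.
Qed.

Lemma proper_answer (s : state R) q : proper_dist (answer A W s q).
Proof. by case: q => *; rewrite /answer; (exact: proper_dist1 || exact: proper_uniform). Qed.

Lemma proper_map (T U : Type) (f : T -> U) (d : seq (R * T)) :
  proper_dist d -> proper_dist [seq (p.1, f p.2) | p <- d].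
Proof. by case=> d0 d1; split; rewrite ?big_map // all_map. Qed.

Lemma proper_step c : ~~ halted c -> proper_dist (step A W c).
Proof.
case: c => -[|c1 K] s //= _.
case: c1 => *; try exact: proper_dist1.
- exact: (proper_map (fun a => (K, set_wvar s _ a)) (proper_answer s _)).
- by apply: (proper_map (fun a => (K, set_wvar s _ a))); apply: proper_uniform; rewrite leq_max.
- exact: (proper_map (fun a => (K, set_wvar s _ a)) (proper_bernoulli _)).
Qed.

Lemma step_halted c : halted c -> step A W c = [::].
Proof. by case: c => -[]. Qed.

Lemma proper_ler (T : Type) (d : seq (R * T)) (F G : T -> R) :
  proper_dist d -> (forall x, F x <= G x) ->
  \sum_(p <- d) p.1 * F p.2 <= \sum_(p <- d) p.1 * G p.2.
Proof.
case=> + _ FG; elim: d => [|p d IH] /=; first by rewrite !big_nil.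
case/andP=> p0 /IH h; rewrite !big_cons lerD // ler_wpM2l //.
Qed.

Lemma proper_ge0 (T : Type) (d : seq (R * T)) (F : T -> R) :
  proper_dist d -> (forall x, 0 <= F x) -> 0 <= \sum_(p <- d) p.1 * F p.2.
Proof.
move=> pd F0; apply: le_trans (proper_ler pd F0).
by rewrite big1 // => p _; rewrite mulr0.
Qed.

Lemma proper_const (T : Type) (d : seq (R * T)) (a : R) :
  proper_dist d -> \sum_(p <- d) p.1 * a = a.
Proof. by case=> _ d1; rewrite -mulr_suml d1 mul1r. Qed.

(** [run] appends steps at the end; the later inductions peel off the first step. *)
Lemma run_first (F : config R -> R) k c :
  \sum_(p <- run A W k.+1 c) p.1 * F p.2 =
  \sum_(p <- step A W c) p.1 * \sum_(q <- run A W k p.2) q.1 * F q.2.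
Proof.
have unf G j : \sum_(p <- run A W j.+1 c) p.1 * G p.2 =
    \sum_(p <- run A W j c) p.1 * \sum_(q <- step A W p.2) q.1 * G q.2.
  rewrite [run _ _ _ _]/= big_allpairs_dep /=; apply: eq_bigr => p _.
  by rewrite mulr_sumr; apply: eq_bigr => q _; rewrite mulrA.
elim: k c F unf => [|k IH] c F unf.
  by rewrite unf /= big_seq1 mul1r; apply: eq_bigr => p _; rewrite big_seq1 mul1r.
rewrite unf (IH c (fun x => \sum_(q <- step A W x) q.1 * F q.2)) //; apply: eq_bigr => p _; congr (_ * _).
rewrite [run _ _ k.+1 _]/= big_allpairs_dep /=; apply: eq_bigr => q _.
by rewrite mulr_sumr; apply: eq_bigr => r _; rewrite mulrA.
Qed.

Definition halts E k c : R :=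
  \sum_(p <- run A W k c | halted p.2 && E (output p.2)) p.1.

Lemma haltsE E k c :
  halts E k c = \sum_(p <- run A W k c) p.1 * (halted p.2 && E (output p.2))%:R.
Proof.
by rewrite /halts big_mkcond; apply: eq_bigr => p _; case: ifP; rewrite ?mulr1 ?mulr0.
Qed.

Lemma halts0 E c : halts E 0 c = (halted c && E (output c))%:R.
Proof. by rewrite haltsE /= big_seq1 mul1r. Qed.

Lemma haltsS E k c : halts E k.+1 c = \sum_(p <- step A W c) p.1 * halts E k p.2.
Proof. by rewrite haltsE (run_first (fun x => (halted x && E (output x))%:R)); apply: eq_bigr => p _; rewrite haltsE. Qed.

Lemma halts_ge0 E k c : 0 <= halts E k c.
Proof.
elim: k c => [|k IH] c; first by rewrite halts0.
rewrite haltsS; case: (boolP (halted c)) => [h|/proper_step pd].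
  by rewrite step_halted // big_nil.
exact: (@proper_ge0 _ _ (halts E k)).
Qed.

Lemma sum_halts E m c :
  \sum_(k < m.+1) halts E k c =
  if halted c then (E (output c))%:R
  else \sum_(p <- step A W c) p.1 * \sum_(k < m) halts E k p.2.
Proof.
rewrite big_ord_recl halts0 /=; case: ifP => h /=.
  rewrite big1 ?addr0 // => k _; by rewrite haltsS step_halted // big_nil.
rewrite add0r; under eq_bigr => k _ do rewrite haltsS.
by rewrite exchange_big /=; apply: eq_bigr => p _; rewrite mulr_sumr.
Qed.

Lemma sum_halts_le1 m c : \sum_(k < m) halts xpredT k c <= 1.
Proof.
elim: m c => [|m IH] c; first by rewrite big_ord0.
rewrite sum_halts; case: ifPn => // /proper_step pd.
by rewrite -[leRHS](proper_const 1 pd); exact: (@proper_ler _ _ (fun c => \sum_(k < m) halts xpredT k c) (fun=> 1)).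
Qed.

Section Value.
(* [value m c] is the expectation, over [m] steps from [c], of [tau] per step
   plus [g] of the output if the computation halts. *)
Variables (tau : R) (g : R -> R).
Hypotheses (tau_ge0 : 0 <= tau) (g_ge0 : forall x, 0 <= g x).

Fixpoint value m c : R :=
  if m is m'.+1 then
    if halted c then g (output c)
    else tau + \sum_(p <- step A W c) p.1 * value m' p.2
  else 0.

Lemma value_ge0 m c : 0 <= value m c.
Proof.
elim: m c => [|m IH] c //=; case: ifPn => // /proper_step pd.
by rewrite addr_ge0 // (@proper_ge0 _ _ (value m)).
Qed.

Lemma value_leS m c : value m c <= value m.+1 c.
Proof.
elim: m c => [|m IH] c; first exact: value_ge0.
rewrite [leLHS]/= [leRHS]/=; case: ifPn => // /proper_step pd.
by rewrite lerD2l; exact: (@proper_ler _ _ (value m) (value m.+1)).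
Qed.

Lemma value_stepS m c : ~~ halted c ->
  value m.+1 c = tau + \sum_(p <- step A W c) p.1 * value m p.2.
Proof. by rewrite /= => /negPf ->. Qed.

(* The horizon is the same on both sides, so that these bounds compose; only
   unbounded loops use the decrease in [value_stepS]. *)
Lemma value_step m c : ~~ halted c ->
  value m c <= tau + \sum_(p <- step A W c) p.1 * value m p.2.
Proof.
by move=> h; apply: le_trans (value_leS m c) _; rewrite value_stepS.
Qed.

End Value.

Lemma value_prob E m c :
  value 0 (fun x => (E x)%:R) m c = \sum_(k < m) halts E k c.
Proof.
elim: m c => [|m IH] c; first by rewrite big_ord0.
rewrite sum_halts /=; case: ifP => // _; rewrite add0r.
by apply: eq_bigr => p _; rewrite IH.
Qed.

(* Both sides are the expectation of min(T, m), where T is the running time. *)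
Lemma value_time m c :
  value 1 (fun=> 0) m c =
  \sum_(k < m) k%:R * halts xpredT k c + m%:R * (1 - \sum_(k < m) halts xpredT k c).
Proof.
elim: m c => [|m IH] c; first by rewrite big_ord0 mul0r addr0.
rewrite sum_halts big_ord_recl mul0r add0r [LHS]/=.
case: ifPn => h.
  rewrite subrr mulr0 addr0 big1 // => k _.
  by rewrite haltsS step_halted // big_nil mulr0.
have pd := proper_step h.
under [in LHS]eq_bigr => p _ do rewrite IH mulrDr.
rewrite big_split /=.
set H := fun p : config R => \sum_(k < m) halts xpredT k p.
have -> : \sum_(i < m) (bump 0 i)%:R * halts xpredT (bump 0 i) c =
  \sum_(p <- step A W c) p.1 * (\sum_(k < m) k%:R * halts xpredT k p.2) +
  \sum_(p <- step A W c) p.1 * H p.2.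
  under eq_bigr => i _ do rewrite haltsS mulr_sumr.
  rewrite exchange_big -big_split /=; apply: eq_bigr => p _.
  rewrite -mulrDr -big_split mulr_sumr /=; apply: eq_bigr => i _.
  rewrite /bump /= add1n -natr1; ring.
have -> : \sum_(p <- step A W c) p.1 * (m%:R * (1 - \sum_(k < m) halts xpredT k p.2)) =
  m%:R * (1 - \sum_(p <- step A W c) p.1 * H p.2).
  rewrite -[X in _ = _ * (X - _)](proper_const 1 pd) -sumrB mulr_sumr.
  by apply: eq_bigr => p _; rewrite /H; ring.
rewrite -natr1 -/(H); rewrite /H; ring.
Qed.

End Semantics.

(** * Deterministic commands *)

Fixpoint straight (c : cmd) : bool :=
  match c with
  | Query _ QRandVertex | RandWord _ _ | Flip _ _ | While _ _ => false
  | Seq c1 c2 | If _ c1 c2 => straight c1 && straight c2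
  | _ => true
  end.

(** Both branches of a conditional are counted, which is an upper bound whichever branch is
    taken. *)
Fixpoint duration (c : cmd) : nat :=
  match c with
  | Seq c1 c2 | If _ c1 c2 => (duration c1 + duration c2).+1
  | _ => 1
  end.

Definition for_loop (x : nat) (N : wexp) (body : cmd) : cmd :=
  Seq (WSet x (WConst 0))
    (While (BNot (BWle N (WVar x))) (Seq body (WSet x (WAdd (WVar x) (WConst 1))))).

Section Logic.
Variables (R : realType) (n : nat) (e : rel 'I_n) (A : adjacency e) (W : nat).
Variables (tau : R) (g : R -> R).
Hypotheses (n_gt0 : (0 < n)%N) (tau_ge0 : 0 <= tau) (g_ge0 : forall x, 0 <= g x).

Local Notation val_ m K s := (value A W tau g m (K, s)).

Definition reply (s : state R) (q : query) : nat := (head (0, 0%N) (answer A W s q)).2.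

Fixpoint final (c : cmd) (s : state R) : state R :=
  match c with
  | WSet x a => set_wvar s x (weval W s a)
  | WPut x i a => set_warr s x (weval W s i) (weval W s a)
  | RSet x a => set_rvar s x (reval W s a)
  | RPut x i a => set_rarr s x (weval W s i) (reval W s a)
  | Query x q => set_wvar s x (reply s q)
  | Seq c1 c2 => final c2 (final c1 s)
  | If b c1 c2 => if beval W s b then final c1 s else final c2 s
  | _ => s
  end.

(** A Hoare triple with a clock, in continuation form: being uniform in the remaining stack and in
    the horizon, it composes, and it can be placed in front of random code. A single final state
    suffices for a command that makes no random choice. *)
Definition exec (c : cmd) (s : state R) (k : nat) (Q : state R -> Prop) : Prop :=
  exists2 s', Q s' & forall m K, val_ m (c :: K) s <= tau * k%:R + val_ m K s'.

Lemma value_det m K s c K' s' : step A W (c :: K, s) = [:: (1, (K', s'))] ->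
  val_ m (c :: K) s <= tau + val_ m K' s'.
Proof.
by move=> st; apply: le_trans (value_step A W n_gt0 tau_ge0 g_ge0 m _) _;
  rewrite // st big_seq1 mul1r.
Qed.

Lemma exec_weaken c s k k' (Q Q' : state R -> Prop) :
  exec c s k Q -> (k <= k')%N -> (forall s', Q s' -> Q' s') -> exec c s k' Q'.
Proof.
case=> s' Qs' h kk QQ; exists s'; first exact: QQ.
move=> m K; apply: le_trans (h m K) _.
by rewrite lerD2r ler_wpM2l // ler_nat.
Qed.

Lemma exec_seq c1 c2 s k1 k2 (Q1 Q2 : state R -> Prop) :
  exec c1 s k1 Q1 -> (forall s', Q1 s' -> exec c2 s' k2 Q2) ->
  exec (Seq c1 c2) s (k1 + k2).+1 Q2.
Proof.
case=> s1 /[swap] h1 Q1s /(_ _ Q1s) [s2 Q2s h2]; exists s2 => // m K.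
have st : step A W (Seq c1 c2 :: K, s) = [:: (1, ([:: c1, c2 & K], s))] by [].
apply: le_trans (value_det _ st) _.
apply: le_trans (lerD (lexx _) (h1 m _)) _.
apply: le_trans (lerD (lexx _) (lerD (lexx _) (h2 m _))) _.
rewrite -addn1 !natrD; lra.
Qed.

Lemma exec_if b c1 c2 s k (Q : state R -> Prop) :
  exec (if beval W s b then c1 else c2) s k Q -> exec (If b c1 c2) s k.+1 Q.
Proof.
case=> s' Qs h; exists s' => // m K.
have st : step A W (If b c1 c2 :: K, s) =
  [:: (1, ((if beval W s b then c1 else c2) :: K, s))] by [].
apply: le_trans (value_det _ st) _.
apply: le_trans (lerD (lexx _) (h m _)) _.
rewrite -natr1; lra.
Qed.

Lemma exec_straight c s (Q : state R -> Prop) :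
  straight c -> Q (final c s) -> exec c s (duration c) Q.
Proof.
move=> + Qs; pose Q' s' := s' = final c s.
move=> sc; suff h : exec c s (duration c) Q'.
  by apply: exec_weaken h _ _ => // s' ->.
rewrite {}/Q'; clear Q Qs; elim: c s sc => //=.
- by move=> s _; exists s => // m K; rewrite mulr1; exact: value_det.
- by move=> x a s _; eexists; [reflexivity|move=> m K; rewrite mulr1; exact: value_det].
- by move=> x i a s _; eexists; [reflexivity|move=> m K; rewrite mulr1; exact: value_det].
- by move=> x a s _; eexists; [reflexivity|move=> m K; rewrite mulr1; exact: value_det].
- by move=> x i a s _; eexists; [reflexivity|move=> m K; rewrite mulr1; exact: value_det].
- move=> x q s sq; eexists; [reflexivity|move=> m K; rewrite mulr1; apply: value_det].
  by case: q sq.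
- move=> c1 IH1 c2 IH2 s /andP[/IH1 h1 /IH2 h2].
  by apply: exec_seq (h1 s) _ => s' ->; exact: h2.
- move=> b c1 IH1 c2 IH2 s /andP[/IH1 h1 /IH2 h2].
  apply: exec_if; case: ifP => _.
    by apply: exec_weaken (h1 s) _ _ => //; exact: leq_addr.
  by apply: exec_weaken (h2 s) _ _ => //; exact: leq_addl.
Qed.

Lemma exec_while_exit b c s (Q : state R -> Prop) :
  ~~ beval W s b -> Q s -> exec (While b c) s 1 Q.
Proof.
move=> /negPf bs Qs; exists s => // m K; rewrite mulr1.
by apply: value_det; rewrite /= bs.
Qed.

Lemma exec_while_loop b c s k1 k2 (Q1 Q : state R -> Prop) :
  beval W s b -> exec c s k1 Q1 -> (forall s', Q1 s' -> exec (While b c) s' k2 Q) ->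
  exec (While b c) s (k1 + k2).+1 Q.
Proof.
move=> bs [s1 Q1s h1] /(_ _ Q1s) [s2 Qs h2]; exists s2 => // m K.
have st : step A W (While b c :: K, s) = [:: (1, ([:: c, While b c & K], s))].
  by rewrite /= bs.
apply: le_trans (value_det _ st) _.
apply: le_trans (lerD (lexx _) (h1 m _)) _.
apply: le_trans (lerD (lexx _) (lerD (lexx _) (h2 m _))) _.
rewrite -addn1 !natrD; lra.
Qed.

(** The bound [N] is evaluated again at every test, so the invariant has to keep its value at [B],
    and [B < W] prevents the counter from wrapping around. Test, sequencing and increment cost 3 per
    iteration; entering the loop and the last test cost another 3. *)
Lemma exec_for (x : nat) (N : wexp) body (B : nat) (Inv : nat -> state R -> Prop)
    (k : nat -> nat) s :
  (B < W)%N -> Inv 0%N (set_wvar s x 0) ->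
  (forall i s', (i <= B)%N -> Inv i s' -> wvar s' x = i /\ weval W s' N = B) ->
  (forall i s', (i < B)%N -> Inv i s' -> exec body s' (k i)
     (fun s'' => wvar s'' x = i /\ Inv i.+1 (set_wvar s'' x i.+1))) ->
  exec (for_loop x N body) s ((\sum_(i < B) (k i + 3)) + 3) (Inv B).
Proof.
move=> BW I0 Icond Istep; rewrite /for_loop.
set wl := While _ _.
have loop j : (j <= B)%N -> forall s', Inv (B - j)%N s' ->
    exec wl s' (\sum_(B - j <= i < B) (k i + 3) + 1) (Inv B).
  elim: j => [|j IH] jB s' Is.
    have [x1 x2] := Icond _ _ (leq_subr 0 B) Is.
    rewrite subn0 in x1 Is *; rewrite big_geq //.
    by apply: exec_while_exit => //=; rewrite x1 x2 negbK.
  have lt : (B - j.+1 < B)%N by rewrite ltn_subrL (leq_trans _ jB).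
  have [x1 x2] := Icond _ _ (leq_subr j.+1 B) Is.
  have ej : ((B - j.+1).+1 = B - j)%N by rewrite subnSK.
  rewrite big_ltn // ej.
  set S := (\sum_(_ <= _ < _) _)%N.
  suff E : exec wl s' ((k (B - j.+1) + 1).+1 + (S + 1)).+1%N (Inv B).
    by apply: exec_weaken E _ _ => //; rewrite /S; lia.
  apply: (@exec_while_loop _ _ _ _ _ (Inv (B - j)%N)).
  - by rewrite /= x1 x2 -ltnNge.
  - apply: exec_seq; first exact: Istep lt Is.
    move=> s1 [w1 I1]; have := @exec_straight (WSet x (WAdd (WVar x) (WConst 1))) s1.
    apply => //=; rewrite w1 modnDmr addn1 modn_small ?(leq_ltn_trans lt) //.
    by rewrite -ej.
  - by move=> s1 I1; apply: IH => //; exact: ltnW.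
have W0 : (0 < W)%N by exact: leq_ltn_trans BW.
apply: exec_weaken.
  apply: (@exec_seq _ _ _ 1 _ (fun s' => s' = set_wvar s x 0)).
    by have := @exec_straight (WSet x (WConst 0)) s; apply => //=; rewrite mod0n.
  by move=> s' ->; apply: (loop B) => //; rewrite subnn.
- by rewrite subnn big_mkord; lia.
- by [].
Qed.

End Logic.

(** * The program *)

(* Word variables: 0 = n, 1 = t, 2 = number of touched vertices, 3 and 12 = loop
   counters, 4 = number of vertices to push, 6 = halting flag; those from 10 on
   are temporaries, and a walk keeps its vertex in 10, its out-degree in 11 and
   whether it is still alive in 13.  Word arrays: 0 = list of the touched
   vertices, 1 = its characteristic function.  Real variables: 0 = alpha (at the
   end, the output), 1 = K, 2 = budget N, 3 = residue bound M, 4 = total amount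
   pushed, 5 = sum of the samples, 6 = cost of a push, 7 = number of samples
   drawn, 8 = power of 2.  Real arrays: 0 = residues, 1 = amounts to push. *)
Local Notation V x := (WVar x).
Local Notation lit k := (WConst k).

Definition threshold : rexp := RDiv (RMul (RVar 0) (RVar 3)) (RWord (lit 2)).

(** The power of 2, like the budget and the sample count, is kept in a real cell and so is never
    reduced modulo [W]. *)
Definition set_scale (c : nat) : cmd :=
  Seq (RSet 8 (RWord (lit 1)))
    (While (BRle (RVar 8) (RWord (V 0)))
       (Seq (RSet 8 (RAdd (RVar 8) (RVar 8))) (RSet 1 (RAdd (RVar 1) (RWord (lit c)))))).

Definition start : cmd :=
  Seq (WPut 0 (lit 0) (V 1)) (Seq (WPut 1 (V 1) (lit 1)) (Seq (WSet 2 (lit 1))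
  (Seq (Query 11 (QOutdeg (V 1)))
  (Seq (If (BWeq (V 11) (lit 0)) (RPut 0 (V 1) (RWord (lit 1))) (RPut 0 (V 1) (RVar 0)))
  (Seq (RSet 2 (RWord (lit 1))) (RSet 3 (RWord (lit 1)))))))).

(** Scanning first serves two purposes: it prices the push before committing to it, and it freezes
    the amounts in real array 1, so that residue arriving during the round is not pushed again. This
    is what makes the push simultaneous. *)
Definition scan_body : cmd :=
  Seq (WSet 10 (WGet 0 (V 3)))
  (If (BRle threshold (RGet 0 (V 10)))
     (Seq (Query 11 (QIndeg (V 10)))
     (Seq (RPut 1 (V 10) (RGet 0 (V 10)))
          (RSet 6 (RAdd (RVar 6) (RAdd (RWord (lit 1)) (RWord (V 11)))))))
     (RPut 1 (V 10) (RWord (lit 0)))).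

Definition scan : cmd :=
  Seq (RSet 6 (RWord (V 2))) (for_loop 3 (V 2) scan_body).

Definition push_edge : cmd :=
  Seq (Query 13 (QIn (V 10) (V 12)))
  (Seq (Query 14 (QOutdeg (V 13)))
  (Seq (RPut 0 (V 13) (RAdd (RGet 0 (V 13))
          (RMul (RDiv (RSub (RWord (lit 1)) (RVar 0)) (RWord (V 14))) (RGet 1 (V 10)))))
  (If (BWeq (WGet 1 (V 13)) (lit 0))
     (Seq (WPut 1 (V 13) (lit 1)) (Seq (WPut 0 (V 2) (V 13)) (WSet 2 (WAdd (V 2) (lit 1)))))
     Skip))).

Definition push_pre : cmd :=
  Seq (RPut 0 (V 10) (RSub (RGet 0 (V 10)) (RGet 1 (V 10))))
  (Seq (RSet 4 (RAdd (RVar 4) (RGet 1 (V 10)))) (Query 11 (QIndeg (V 10)))).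

Definition push_body : cmd :=
  Seq (WSet 10 (WGet 0 (V 3)))
  (If (BNot (BRle (RGet 1 (V 10)) (RWord (lit 0))))
     (Seq push_pre (for_loop 12 (V 11) push_edge))
     Skip).

(** The length of the list is frozen in variable 4 because [push_edge] appends vertices that were
    not scanned in this round. *)
Definition push : cmd :=
  Seq (WSet 4 (V 2)) (Seq (for_loop 3 (V 4) push_body)
    (RSet 3 (RSub (RVar 3) threshold))).

Definition walk_move : cmd :=
  Seq (RandWord 12 (V 11)) (Query 10 (QOut (V 10) (V 12))).

Definition walk_branch : cmd := If (BWeq (V 14) (lit 1)) (WSet 13 (lit 0)) walk_move.

Definition walk_coin : cmd := Seq (Flip 14 (RVar 0)) walk_branch.

Definition walk_test : cmd := If (BWeq (V 11) (lit 0)) (WSet 13 (lit 0)) walk_coin.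

Definition walk_body : cmd := Seq (Query 11 (QOutdeg (V 10))) walk_test.

Definition walk : cmd := While (BWeq (V 13) (lit 1)) walk_body.

Definition record_sample : cmd :=
  Seq (If (BWeq (V 11) (lit 0))
         (RSet 5 (RAdd (RVar 5) (RGet 0 (V 10))))
         (RSet 5 (RAdd (RVar 5) (RDiv (RGet 0 (V 10)) (RVar 0)))))
      (RSet 7 (RAdd (RVar 7) (RWord (lit 1)))).

Definition samples : cmd :=
  While (BNot (BRle (RVar 2) (RVar 7)))
    (Seq (Query 10 QRandVertex) (Seq (WSet 13 (lit 1)) (Seq walk record_sample))).

(** Pushed mass [P] contributes exactly [P / n] to the PageRank; starting the sum at [N P / n] makes
    its final mean [N] times the PageRank. *)
Definition sample_pre : cmd :=
  Seq (RSet 5 (RDiv (RMul (RVar 2) (RVar 4)) (RWord (V 0)))) (RSet 7 (RWord (lit 0))).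

Definition finish : cmd :=
  If (BRle (RMul (RVar 1) (RVar 3)) (RVar 5))
     (Seq (RSet 0 (RDiv (RVar 5) (RVar 2))) (WSet 6 (lit 1))) Skip.

Definition adapt : cmd :=
  Seq scan (If (BRle (RVar 6) (RVar 2)) push (RSet 2 (RAdd (RVar 2) (RVar 2)))).

Definition main_loop : cmd :=
  While (BWeq (V 6) (lit 0)) (Seq adapt (Seq sample_pre (Seq samples finish))).

Definition program (c : nat) : cmd := Seq (set_scale c) (Seq start main_loop).

(** * Scanning the touched vertices and pushing along the in-edges of one vertex *)

Section Deterministic.
Variables (R : realType) (alpha : R) (n : nat) (e : rel 'I_n) (A : adjacency e).
Variables (W : nat) (tau : R) (g : R -> R).
Hypotheses (alpha01 : 0 < alpha < 1) (tau_ge0 : 0 <= tau) (g_ge0 : forall x, 0 <= g x).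
Hypotheses (n_gt0 : (0 < n)%N) (nW : (n < W)%N) (W_gt2 : (2 < W)%N).

Implicit Types (s : state R) (L : seq 'I_n) (x : 'I_n -> R) (K b M P : R).

Definition scalars s K b M : Prop :=
  [/\ wvar s 0 = n, wvar s 6 = 0%N, rvar s 0 = alpha, rvar s 1 = K
    & rvar s 2 = b /\ rvar s 3 = M].

Definition touched s L : Prop :=
  [/\ wvar s 2 = size L,
      forall i, (i < size L)%N -> warr s 0 i = nth 0%N (map val L) i
    & forall v : 'I_n, warr s 1 v = (v \in L)].

Definition residue s x : Prop := forall v : 'I_n, rarr s 0 v = x v.

Definition amount M x (v : 'I_n) : R := if alpha * M / 2 <= x v then x v else 0.

Definition cost M x L : nat :=
  (size L + \sum_(v <- L | (alpha * M / 2 <= x v)%R) (1 + indeg e v))%N.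

Local Notation exec := (exec A W tau g).

Let W0 : (0 %% W = 0)%N. Proof. by rewrite mod0n. Qed.
Let W1 : (1 %% W = 1)%N. Proof. by rewrite modn_small // ltnW. Qed.
Let W2 : (2 %% W = 2)%N. Proof. by rewrite modn_small. Qed.

Lemma reply_indeg s a (v : 'I_n) :
  weval W s a = v -> reply A W s (QIndeg a) = indeg e v.
Proof.
rewrite /reply /= => ->; rewrite valK /= -(card_uniqP (ins_uniq A v)) /indeg cardsE.
by apply: eq_card => u; rewrite mem_ins.
Qed.

Lemma reply_outdeg s a (v : 'I_n) :
  weval W s a = v -> reply A W s (QOutdeg a) = outdeg e v.
Proof.
rewrite /reply /= => ->; rewrite valK /= -(card_uniqP (outs_uniq A v)) /outdeg cardsE.
by apply: eq_card => u; rewrite mem_outs.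
Qed.

Lemma size_ins (v : 'I_n) : size (ins A v) = indeg e v.
Proof.
rewrite -(card_uniqP (ins_uniq A v)) /indeg cardsE.
by apply: eq_card => u; rewrite mem_ins.
Qed.

Lemma reply_in s a i (v : 'I_n) j : weval W s a = v -> weval W s i = j ->
  reply A W s (QIn a i) = nth 0%N (map val (ins A v)) j.
Proof. by rewrite /reply /= => -> ->; rewrite valK. Qed.

Lemma uniq_size L : uniq L -> (size L <= n)%N.
Proof. by move=> uL; rewrite -{2}(card_ord n) -(card_uniqP uL) max_card. Qed.

Lemma nth_val L i v0 : (i < size L)%N -> nth 0%N (map val L) i = val (nth v0 L i).
Proof. by move=> iL; rewrite (nth_map v0). Qed.

Arguments reply : simpl never.

Lemma exec_scan s K b M P L x :
  uniq L -> scalars s K b M -> touched s L -> residue s x -> rvar s 4 = P ->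
  exec scan s (12 * size L + 5)%N (fun s' =>
    [/\ scalars s' K b M, touched s' L, residue s' x, rvar s' 4 = P
      & (forall v, v \in L -> rarr s' 1 v = amount M x v) /\
        rvar s' 6 = (cost M x L)%:R]).
Proof.
move=> uL sc tL rx sP.
pose Inv i s' := [/\ [/\ scalars s' K b M, touched s' L & residue s' x],
  rvar s' 4 = P, wvar s' 3 = i,
  rvar s' 6 = (size L + \sum_(v <- take i L | (alpha * M / 2 <= x v)%R) (1 + indeg e v))%:R
  & forall v, v \in take i L -> rarr s' 1 v = amount M x v].
have LW : (size L < W)%N := leq_ltn_trans (uniq_size uL) nW.
apply: (exec_weaken tau_ge0 (k := (1 + (\sum_(i < size L) (9 + 3) + 3)).+1)
  (Q := Inv (size L))); last first.
- by move=> s' []; rewrite take_size => -[? ? ?] ? ? ? ?; split.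
- by rewrite sum_nat_const card_ord; lia.
apply: (exec_seq n_gt0 tau_ge0 g_ge0 (Q1 := Inv 0%N \o fun s => set_wvar s 3 0)).
  apply: exec_straight => //=; split => //=.
    by case: tL => -> _ _; rewrite take0 big_nil addn0.
  by rewrite take0.
move=> s' I0; apply: (exec_for n_gt0 tau_ge0 g_ge0 (Inv := Inv) (k := fun=> 9%N)) => //.
  by move=> i s1 _ [[_ [? _ _] _] _ ? _ _].
move=> i s1 iL [[sc1 tL1 rx1] P1 i1 c1 a1].
have v0 : 'I_n := Ordinal n_gt0.
apply: exec_straight => //=.
set v := nth v0 L i.
have wv : warr s1 0 (wvar s1 3) = v by rewrite i1; case: tL1 => _ -> // _; exact: nth_val.
case: (sc1) => e0 e6 ra rK [rb rM].
rewrite wv rM ra W2 rx1.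
have tk : take i.+1 L = rcons (take i L) v by rewrite (take_nth v0).
case: ifPn => xv.
  split; first by [].
  rewrite (@reply_indeg _ _ v) //.
  split => //=.
    by rewrite tk -cats1 big_cat /= big_cons big_nil xv c1 W1 addn0 -!natrD; congr (_%:R); rewrite -!addnA /upd /=.
  move=> w; rewrite tk mem_rcons inE /upd /= => /orP[/eqP ->|wL].
    by rewrite eqxx /amount xv.
  case: eqP => [/val_inj ->|_]; first by rewrite /amount xv.
  exact: a1.
split; first by [].
split => //=.
  by rewrite tk -cats1 big_cat /= big_cons big_nil (negPf xv) addn0.
move=> w; rewrite tk mem_rcons inE /upd W0 /= => /orP[/eqP ->|wL].
  by rewrite eqxx /amount (negPf xv).
case: eqP => [/val_inj ->|_]; first by rewrite /amount (negPf xv).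
exact: a1.
Qed.

Lemma touched_rcons s L (u : 'I_n) : touched s L -> u \notin L ->
  touched (set_wvar (set_warr (set_warr s 1 u 1) 0 (size L) u) 2 (size L).+1) (rcons L u).
Proof.
case=> t2 t0 t1 uL; split=> /=; first by rewrite size_rcons.
- move=> i; rewrite size_rcons ltnS map_rcons nth_rcons size_map /upd /= => iL.
  case: eqP => [->|/eqP ne]; first by rewrite ltnn.
  by rewrite ltn_neqAle ne iL t0 // ltn_neqAle ne.
- move=> w; rewrite mem_rcons inE /upd /= val_eqE.
  by case: eqP => //= _; exact: t1.
Qed.

(** Vertices are appended at the end of the list, so the positions used by the enclosing loop stay
    valid; [ins A v] is free of repetitions, so every in-neighbour receives its share once. *)
Lemma exec_edges s K b M P L x (v : 'I_n) i D :
  uniq L -> scalars s K b M -> touched s L -> residue s x -> rvar s 4 = P ->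
  wvar s 3 = i -> wvar s 4 = D -> wvar s 10 = v -> wvar s 11 = indeg e v ->
  exec (for_loop 12 (V 11) push_edge) s (16 * indeg e v + 3)%N (fun s' =>
    exists2 L', [/\ uniq L', exists l, L' = L ++ l & forall u, (u \in L') = (u \in L) || e u v]
    & [/\ scalars s' K b M, touched s' L',
          residue s' (fun u => x u + if e u v then hop alpha e u * rarr s 1 v else 0),
          rvar s' 4 = P
        & [/\ wvar s' 3 = i, wvar s' 4 = D & rarr s' 1 =1 rarr s 1]]).
Proof.
move=> uL sc tL rx sP si sD sv sd.
pose Inv j s' := exists2 L',
    [/\ uniq L', exists l, L' = L ++ l
       & forall u, (u \in L') = (u \in L) || (u \in take j (ins A v))]
  & [/\ scalars s' K b M, touched s' L',
        residue s' (fun u => x u +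
          if u \in take j (ins A v) then hop alpha e u * rarr s 1 v else 0),
        rvar s' 4 = P
      & [/\ wvar s' 3 = i, wvar s' 4 = D, wvar s' 10 = v, wvar s' 11 = indeg e v
          & wvar s' 12 = j /\ rarr s' 1 =1 rarr s 1]].
have dW : (indeg e v < W)%N.
  by apply: leq_ltn_trans nW; rewrite -[X in (_ <= X)%N](card_ord n) max_card.
apply: (exec_weaken tau_ge0 (k := (\sum_(j < indeg e v) (13 + 3) + 3)%N)
  (Q := Inv (indeg e v))); last first.
- move=> s' [L' [h1 h2 h3] [h4 h5 h6 h7 [h8 h9 h10 h11 [h12 h13]]]].
  exists L'; first by split => // u; rewrite h3 -size_ins take_size mem_ins.
  by split => // u; rewrite h6 -size_ins take_size mem_ins.
- by rewrite sum_nat_const card_ord; lia.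
apply: (exec_for n_gt0 tau_ge0 g_ge0 (Inv := Inv) (k := fun=> 13%N)) => //.
- exists L; first by split => //; [exists [::]; rewrite cats0|move=> u; rewrite take0 orbF].
  by split => // u /=; rewrite take0 addr0; exact: rx.
- by move=> j s1 _ [L' _ [_ _ _ _ [_ _ _ ? [? _]]]].
move=> j s1 jd [L1 [uL1 [l eL1] mL1]].
move=> [sc1 tL1 rx1 P1 [i1 D1 v1 d1 [j1 a1]]].
apply: exec_straight => //.
have jd' : (j < size (ins A v))%N by rewrite size_ins.
set u := nth v (ins A v) j.
have tk : take j.+1 (ins A v) = rcons (take j (ins A v)) u by rewrite (take_nth v).
have uj : u \notin take j (ins A v).
  have := take_uniq j.+1 (ins_uniq A v); rewrite tk rcons_uniq; by case/andP.
set s2 := set_wvar s1 13 u.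
set s3 := set_wvar s2 14 (outdeg e u).
set s4 := set_rarr s3 0 u (x u + hop alpha e u * rarr s 1 v).
have f4 : final A W (Seq (Query 13 (QIn (V 10) (V 12))) (Seq (Query 14 (QOutdeg (V 13)))
  (RPut 0 (V 13) (RAdd (RGet 0 (V 13))
          (RMul (RDiv (RSub (RWord (lit 1)) (RVar 0)) (RWord (V 14))) (RGet 1 (V 10))))))) s1
   = s4.
  rewrite [final _ _ _ _]/= (@reply_in _ _ _ v j) //= (nth_val v) // -/u -/s2.
  rewrite (@reply_outdeg _ _ u) //= -/s3 /s4; congr (set_rarr _ _ _ _).
  rewrite /upd /= v1 W1; case: sc1 => _ _ -> _ _.
  by rewrite rx1 (negPf uj) addr0 a1.
have -> : final A W push_edge s1 = final A W (If (BWeq (WGet 1 (V 13)) (lit 0))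
     (Seq (WPut 1 (V 13) (lit 1)) (Seq (WPut 0 (V 2) (V 13)) (WSet 2 (WAdd (V 2) (lit 1)))))
     Skip) s4.
  by rewrite -f4.
have rx4 : residue s4 (fun w => x w +
          if w \in take j.+1 (ins A v) then hop alpha e w * rarr s 1 v else 0).
  move=> w; rewrite tk mem_rcons inE /s4 /= /upd /= val_eqE.
  by case: eqP => [->|_] //=; exact: rx1.
have mk : warr s4 1 (wvar s4 13) = (u \in L1) by case: tL1 => _ _ <-.
rewrite /= mk W0; case: ifPn => /= uL1'; last first.
  have {}uL1' : u \in L1 by move: uL1'; case: (_ \in _).
  split => //; exists L1.
    split => //; first by exists l.
    move=> w; rewrite mL1 tk mem_rcons inE.
    case: eqP => [->|_] //=; rewrite -mL1 uL1' ; by rewrite orbT.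
  by split.
have {}uL1' : u \notin L1 by move: uL1'; case: (_ \in _).
have ur : uniq (rcons L1 u) by rewrite rcons_uniq uL1' uL1.
have sz := uniq_size ur; rewrite size_rcons in sz.
have t2 : wvar s4 2 = size L1 by case: tL1.
rewrite /upd /= W1 -/(wvar s1 2).
have -> : wvar s1 2 = size L1 by case: tL1.
rewrite addn1 modn_small ?(leq_ltn_trans sz) //.
split => //; exists (rcons L1 u).
  split => //; first by exists (rcons l u); rewrite eL1 rcons_cat.
  move=> w; rewrite tk !mem_rcons !inE mL1.
  by case: (w == u); rewrite ?orbT.
split => //.
exact: (@touched_rcons s4 L1 u).
Qed.

End Deterministic.

(** * The simultaneous push of all scanned vertices *)

Section Push.
Variables (R : realType) (alpha : R) (n : nat) (e : rel 'I_n) (A : adjacency e).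
Variables (W : nat) (tau : R) (g : R -> R).
Hypotheses (alpha01 : 0 < alpha < 1) (tau_ge0 : 0 <= tau) (g_ge0 : forall x, 0 <= g x).
Hypotheses (n_gt0 : (0 < n)%N) (nW : (n < W)%N) (W_gt2 : (2 < W)%N).

Local Notation exec := (exec A W tau g).
Local Notation scalars := (scalars alpha n).

Lemma exec_push (s : state R) K b M P (L : seq 'I_n) (x : 'I_n -> R) :
  let a := amount alpha M x in
  uniq L -> (forall v, 0 <= x v) ->
  scalars s K b M -> touched s L -> residue s x -> rvar s 4 = P ->
  (forall v, v \in L -> rarr s 1 v = a v) ->
  exec push s (16 * cost alpha e M x L + 9)%N (fun s' =>
    exists2 L', uniq L' /\
        (forall u, (u \in L') = (u \in L) || has (fun v => (0 < a v) && e u v) L)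
    & [/\ scalars s' K b (M - alpha * M / 2), touched s' L',
          residue s' (fun u => x u - \sum_(v <- L | v == u) a v +
                        hop alpha e u * \sum_(v <- L | e u v) a v)
        & rvar s' 4 = P + \sum_(v <- L) a v]).
Proof.
move=> a uL x0 sc tL rx sP sa.
have v0 : 'I_n := Ordinal n_gt0.
have LW : (size L < W)%N := leq_ltn_trans (uniq_size uL) nW.
pose x_ i u := x u - \sum_(v <- take i L | v == u) a v +
                 hop alpha e u * \sum_(v <- take i L | e u v) a v.
pose Inv i s' := exists2 L', [/\ uniq L', exists l, L' = L ++ l &
   forall u, (u \in L') = (u \in L) || has (fun v => (0 < a v) && e u v) (take i L)]
  & [/\ scalars s' K b M, touched s' L', residue s' (x_ i),
        rvar s' 4 = P + \sum_(v <- take i L) a v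
      & [/\ wvar s' 3 = i, wvar s' 4 = size L
          & forall v, v \in L -> rarr s' 1 v = a v]].
pose k i := if 0 < a (nth v0 L i) then (16 * indeg e (nth v0 L i) + 12)%N else 4%N.
have a_gt0 v : 0 < a v -> alpha * M / 2 <= x v.
  by rewrite /a /amount; case: ifP => //; rewrite ltxx.
(* A vertex with nothing to push costs 7, paid by its unit in [size L]; a pushed one costs
   [16 * indeg + 15], paid by its term [1 + indeg]. *)
have sumk : (\sum_(i < size L) (k i + 3) <= 16 * cost alpha e M x L)%N.
  rewrite -(big_mkord xpredT (fun i => (k i + 3)%N)) /k.
  rewrite -(big_nth v0 xpredT (fun v => ((if (0 < a v)%R then (16 * indeg e v + 12)%N else 4%N) + 3)%N)).
  rewrite /cost mulnDr -sum1_size 2!big_distrr /= -2?big_split /=.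
  rewrite [X in (_ <= _ + X)%N]big_mkcond -big_split /=.
  apply: leq_sum => v _; case: ifPn => [/a_gt0 ->|_]; first by lia.
  by case: ifP => _; lia.
have scan_ok : exec (for_loop 3 (V 4) push_body) (set_wvar s 4 (size L))
    (\sum_(i < size L) (k i + 3) + 3)%N (Inv (size L)).
  apply: (exec_for n_gt0 tau_ge0 g_ge0 (Inv := Inv) (k := k)) => //.
  - exists L; first by split=> // [|u]; [exists [::]; rewrite cats0|rewrite take0 orbF].
    split => //; last by rewrite take0 big_nil addr0.
    by move=> u; rewrite /x_ take0 !big_nil subr0 mulr0 addr0; exact: rx.
  - by move=> i s1 _ [L' _ [_ _ _ _ [? ? _]]].
  move=> i s1 iL [L1 [uL1 [l eL1] mL1] [sc1 tL1 rx1 P1 [i1 D1 a1]]].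
  set v := nth v0 L i.
  have vL : v \in L by exact: mem_nth.
  have tk : take i.+1 L = rcons (take i L) v by rewrite (take_nth v0).
  have vi : v \notin take i L.
    by have := take_uniq i.+1 uL; rewrite tk rcons_uniq; case/andP.
  have sumS (Pr : pred 'I_n) : \sum_(w <- take i.+1 L | Pr w) a w =
     \sum_(w <- take i L | Pr w) a w + (if Pr v then a v else 0).
    rewrite tk -cats1 big_cat /= big_cons big_nil; congr (_ + _).
    by case: ifP => _; rewrite ?addr0.
  have wv : warr s1 0 i = v.
    case: tL1 => _ -> //; last by rewrite eL1 size_cat ltn_addr.
    by rewrite (nth_val v0) ?eL1 ?size_cat ?ltn_addr // nth_cat iL.
  have -> : k i = (1 + (if (0 < a v)%R then (5 + (16 * indeg e v + 3)).+1%N else 1%N).+1).+1.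
    by rewrite /k -/v; case: ifP => _ //; lia.
  apply: (exec_seq n_gt0 tau_ge0 g_ge0 (Q1 := fun s' => s' = set_wvar s1 10 v)).
    have := @exec_straight _ _ _ A W tau g n_gt0 tau_ge0 g_ge0 (WSet 10 (WGet 0 (V 3))) s1.
    by apply => //=; rewrite i1 wv.
  move=> _ ->; apply: exec_if => //=.
  rewrite /upd /= a1 // mod0n -ltNge.
  case: ifPn => av; last first.
    apply: exec_straight => //=.
    have av0 : a v = 0.
      apply/eqP; move: av; rewrite -leNgt eq_le => -> /=.
      by rewrite /a /amount; case: ifP.
    split => //; exists L1.
      split => //; [by exists l|move=> u; rewrite mL1 tk -cats1 has_cat /=].
      by rewrite av0 ltxx /= orbF.
    split => //; last by rewrite sumS /= av0 addr0.
    by move=> u; rewrite /= rx1 /x_ !sumS av0 !if_same !addr0.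
  pose s2 := set_wvar (set_rvar (set_rarr (set_wvar s1 10 v) 0 v (x_ i v - a v)) 4
     (P + \sum_(w <- take i L) a w + a v)) 11 (indeg e v).
  apply: (exec_seq n_gt0 tau_ge0 g_ge0 (Q1 := fun s' => s' = s2)).
    apply: exec_straight => //.
    rewrite [final _ _ _ _]/= (@reply_indeg _ _ _ _ _ _ _ v) //= /s2.
    by rewrite /upd /= P1 rx1 a1.
  move=> _ ->.
  apply: (exec_weaken tau_ge0); first apply: (@exec_edges _ alpha _ _ _ _ _ _ alpha01 tau_ge0 g_ge0 n_gt0 nW W_gt2 s2 K b M
     (P + \sum_(w <- take i L) a w + a v) L1 (fun u => x_ i u - if v == u then a v else 0) v i (size L)) => //.
  - move=> w; rewrite /s2 /= /upd /= val_eqE eq_sym.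
    by case: eqP => [<-|_] //=; rewrite subr0; exact: rx1.
  - by [].
  move=> s3 [L2 [uL2 [l2 eL2] mL2] [sc3 tL3 rx3 P3 [i3 D3 a3]]].
  split => //; exists L2.
    split => //; first by exists (l ++ l2); rewrite eL2 eL1 catA.
    move=> u; rewrite mL2 mL1 tk -cats1 has_cat /= av orbF.
    by rewrite orbA.
  split => //.
  - move=> u; rewrite /= rx3 /x_ !sumS /s2 /= /upd /= a1 //.
    case: (v == u); case: (e u v); ring.
  - by rewrite sumS /= addrA.
  - by split => // w wL; rewrite /= a3 /s2 /= /upd /= a1.
apply: (exec_weaken tau_ge0 (k := (1 + (\sum_(i < size L) (k i + 3) + 3 + 1).+1).+1)); last first.
- by move=> s' /= h; exact: h.
- by move: sumk; lia.
apply: (exec_seq n_gt0 tau_ge0 g_ge0 (Q1 := fun s' => s' = set_wvar s 4 (size L))).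
  have := @exec_straight _ _ _ A W tau g n_gt0 tau_ge0 g_ge0 (WSet 4 (V 2)) s.
  by apply => //=; case: tL => ->.
move=> _ ->.
apply: (exec_seq n_gt0 tau_ge0 g_ge0 scan_ok).
move=> s1 [L1 [uL1 _ mL1] [sc1 tL1 rx1 P1 _]].
apply: exec_straight => //=.
rewrite take_size in mL1; rewrite /x_ take_size in rx1; rewrite take_size in P1.
exists L1 => //; split => //.
case: sc1 => h1 h2 h3 h4 [h5 h6]; split => //; split => //=.
by rewrite /upd /= h3 h6 modn_small.
Qed.

End Push.

(** * Sampling *)

Section Averages.
Variables (R : realType) (I : finType) (mu y : I -> R).
Hypotheses (mu_ge0 : forall u, 0 <= mu u) (mu_sum : \sum_u mu u = 1).

(** One independent sample added to the running sum [z]. Iterating this operator stands for drawing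
    several samples, without a product space. *)
Definition average (F : R -> R) (z : R) : R := \sum_u mu u * F (z + y u).

Lemma average_mono F G : (forall z, F z <= G z) -> forall z, average F z <= average G z.
Proof. by move=> FG z; apply: ler_sum => u _; rewrite ler_wpM2l. Qed.

(** Expanding around the mean, the linear term in [y u - mean] averages to zero and each sample adds
    at most [var]: variances of independent samples add up. *)
Lemma iter_average_quadratic (c0 c2 m mean var : R) j z :
  0 <= c2 -> \sum_u mu u * y u = mean -> \sum_u mu u * (y u - mean) ^+ 2 <= var ->
  iter j average (fun z => c0 + c2 * (z - m) ^+ 2) z <=
  c0 + c2 * ((z + j%:R * mean - m) ^+ 2 + j%:R * var).
Proof.
move=> c20 ey vy; elim: j z => [|j IH] z.
  by rewrite /= !mul0r !addr0.
rewrite /=; apply: le_trans (average_mono IH z) _; rewrite /average.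
set d := z + j%:R * mean - m + mean.
have -> : \sum_u mu u * (c0 + c2 * ((z + y u + j%:R * mean - m) ^+ 2 + j%:R * var)) =
  \sum_u (mu u * (c0 + c2 * (d ^+ 2 + j%:R * var) - c2 * 2 * d * mean)
     + (c2 * 2 * d) * (mu u * y u) + c2 * (mu u * (y u - mean) ^+ 2)).
  by apply: eq_bigr => u _; rewrite /d; ring.
rewrite !big_split /= -mulr_suml -!mulr_sumr mu_sum ey mul1r.
have h := ler_wpM2l c20 vy; rewrite -[j.+1%:R]natr1.
have -> : z + (j%:R + 1) * mean - m = d by rewrite /d; ring.
have -> : c0 + c2 * (d ^+ 2 + (j%:R + 1) * var) =
  c0 + c2 * (d ^+ 2 + j%:R * var) + c2 * var by ring.
lra.
Qed.

End Averages.

Section Sampling.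
Variables (R : realType) (alpha : R) (n : nat) (e : rel 'I_n) (A : adjacency e).
Variables (W : nat) (tau : R) (g : R -> R).
Hypotheses (alpha01 : 0 < alpha < 1) (tau_ge0 : 0 <= tau) (g_ge0 : forall x, 0 <= g x).
Hypotheses (n_gt0 : (0 < n)%N) (nW : (n < W)%N) (W_gt2 : (2 < W)%N).

Local Notation val_ m K s := (value A W tau g m (K, s)).

Let alpha_gt0 : 0 < alpha. Proof. by case/andP: alpha01. Qed.
Let W0 : (0 %% W = 0)%N. Proof. by rewrite mod0n. Qed.
Let W1 : (1 %% W = 1)%N. Proof. by rewrite modn_small // ltnW. Qed.

Lemma value_mono m m' c : (m <= m')%N -> value A W tau g m c <= value A W tau g m' c.
Proof.
move=> /subnK <-; elim: (m' - m)%N => // k IH.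
exact: le_trans IH (value_leS _ _ _ _ _ _ _).
Qed.

Lemma value_final c m K s : straight c ->
  val_ m (c :: K) s <= tau * (duration c)%:R + val_ m K (final A W c s).
Proof.
move=> sc.
by have [s' -> h] := exec_straight n_gt0 tau_ge0 g_ge0 (Q := fun s' => s' = final A W c s) sc erefl.
Qed.

Lemma value_rand_vertex x m K s :
  val_ m (Query x QRandVertex :: K) s <=
  tau + n%:R^-1 * \sum_(j < n) val_ m K (set_wvar s x j).
Proof.
apply: le_trans (value_step A W n_gt0 tau_ge0 g_ge0 _ _) _ => //.
by rewrite /= big_map (sum_uniform n (fun j => val_ m K (set_wvar s x j))).
Qed.

Lemma value_rand_word x a m K s : (0 < weval W s a)%N ->
  val_ m (RandWord x a :: K) s <=
  tau + (weval W s a)%:R^-1 * \sum_(j < weval W s a) val_ m K (set_wvar s x j).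
Proof.
move=> a0; apply: le_trans (value_step A W n_gt0 tau_ge0 g_ge0 _ _) _ => //.
rewrite /= big_map (sum_uniform _ (fun j => val_ m K (set_wvar s x j))).
by rewrite (maxn_idPr a0).
Qed.

Lemma value_flip x p m K s : 0 <= reval W s p <= 1 ->
  val_ m (Flip x p :: K) s <=
  tau + (reval W s p * val_ m K (set_wvar s x 1) +
         (1 - reval W s p) * val_ m K (set_wvar s x 0)).
Proof.
case/andP=> p0 p1; apply: le_trans (value_step A W n_gt0 tau_ge0 g_ge0 _ _) _ => //.
rewrite /= /bernoulli01 (min_idPr p1) (max_idPr p0) /= !big_cons big_nil addr0 //=.
Qed.

Definition ppr_mean (F : 'I_n -> R) (v : 'I_n) : R := \sum_u ppr alpha e v u * F u.

Lemma ppr_mean_first F v : ppr_mean F v =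
  stop_prob alpha e v * F v + hop alpha e v * \sum_(w | e v w) ppr_mean F w.
Proof.
rewrite /ppr_mean.
under eq_bigr => u _ do rewrite ppr_first // mulrDl.
rewrite big_split /=; congr (_ + _).
  rewrite (bigD1 v) //= eqxx mulr1 big1 ?addr0 // => u.
  by rewrite eq_sym => /negPf ->; rewrite mulr0 mul0r.
transitivity (\sum_u \sum_(w | e v w) hop alpha e v * (ppr alpha e w u * F u)).
  apply: eq_bigr => u _; rewrite mulr_suml.
  by apply: eq_bigr => w _; rewrite mulrA.
rewrite exchange_big mulr_sumr /=; apply: eq_bigr => w _; by rewrite mulr_sumr.
Qed.

Definition walk_frame (s s' : state R) : Prop :=
  [/\ forall y, (y < 10)%N -> wvar s' y = wvar s y, warr s' = warr s,
      rvar s' = rvar s & rarr s' = rarr s].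

Lemma walk_frame_trans s1 s2 s3 : walk_frame s1 s2 -> walk_frame s2 s3 -> walk_frame s1 s3.
Proof.
case=> a b c d [a' b' c' d']; split; rewrite ?b' ?c' ?d' // => y y10.
by rewrite a' // a.
Qed.

Lemma walk_frame_set s x a : (10 <= x)%N -> walk_frame s (set_wvar s x a).
Proof.
by move=> x10; split => //= y y10; rewrite /upd; case: eqP => // ?; lia.
Qed.

(** An iteration takes at most 10 units and the walk survives it with probability at most
    [1 - alpha]; [10 / alpha] solves [T = 10 + (1 - alpha) T]. *)
Lemma value_walk (F : 'I_n -> R) m K s (v : 'I_n) :
  rvar s 0 = alpha -> wvar s 10 = v -> wvar s 13 = 1%N ->
  (forall s' (u : 'I_n), walk_frame s s' -> wvar s' 10 = u -> wvar s' 11 = outdeg e u ->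
     val_ m K s' <= F u) ->
  val_ m (walk :: K) s <= tau * (10 / alpha) + ppr_mean F v.
Proof.
move=> + + + FK.
(* The walk has no bound on its length, so the induction is on the horizon, and the bound on the
   continuation is needed at all smaller horizons. *)
have {FK} : forall m', (m' <= m)%N -> forall s' (u : 'I_n), walk_frame s s' ->
   wvar s' 10 = u -> wvar s' 11 = outdeg e u -> val_ m' K s' <= F u.
  by move=> m' mm s' u fr h1 h2; apply: le_trans (FK _ _ fr h1 h2); exact: value_mono.
(* At horizon 0 the value is 0, so the bound on the continuation itself yields [0 <= F u]. *)
have F0 : (forall m', (m' <= m)%N -> forall s' (u : 'I_n), walk_frame s s' ->
   wvar s' 10 = u -> wvar s' 11 = outdeg e u -> val_ m' K s' <= F u) ->
   forall u, 0 <= F u.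
  move=> FK u; apply: le_trans (FK 0%N _ (set_wvar (set_wvar s 10 u) 11 (outdeg e u)) u _ _ _) => //.
  by apply: walk_frame_trans; apply: walk_frame_set.
move=> FK; have {}F0 := F0 FK; move: FK.
elim: m s v => [|m IH] s v FK ra sv s13.
  rewrite /= addr_ge0 //; first by rewrite mulr_ge0 // divr_ge0 // ltW.
  by apply: sumr_ge0 => u _; rewrite mulr_ge0 // ppr_ge0.
have fr0 : walk_frame s s by [].
have FKm m' : (m' <= m)%N -> forall s' (u : 'I_n), walk_frame s s' ->
   wvar s' 10 = u -> wvar s' 11 = outdeg e u -> val_ m' K s' <= F u.
  by move=> mm; apply: FK; exact: leqW.
rewrite value_stepS //= s13 W1 big_seq1 mul1r /=.
set s1 := set_wvar s 11 (outdeg e v).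
have fr1 : walk_frame s s1 by exact: walk_frame_set.
have stopE s' : walk_frame s s' -> wvar s' 10 = v -> wvar s' 11 = outdeg e v ->
    val_ m [:: WSet 13 (lit 0), walk & K] s' <= tau * 2 + F v.
  move=> fr h10 h11.
  apply: le_trans (value_final _ _ _ _) _ => //=.
  have st : step A W (walk :: K, set_wvar s' 13 0) = [:: (1, (K, set_wvar s' 13 0))].
    by rewrite /= W1.
  rewrite W0; apply: le_trans (lerD (lexx _) (value_det n_gt0 tau_ge0 g_ge0 m st)) _.
  have := FKm m (leqnn m) (set_wvar s' 13 0) v; move=> /(_ _ h10 h11) h.
  have : val_ m K (set_wvar s' 13 0) <= F v by apply: h; apply: walk_frame_trans fr _; exact: walk_frame_set.
  by move=> h'; rewrite mulr1; lra.
have st1 : step A W (walk_body :: walk :: K, s) =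
   [:: (1, ([:: Query 11 (QOutdeg (V 10)), walk_test, walk & K], s))] by [].
apply: le_trans (lerD (lexx _) (value_det n_gt0 tau_ge0 g_ge0 m st1)) _.
apply: le_trans (lerD (lexx _) (lerD (lexx _) (value_final _ _ _ _))) _ => //=.
rewrite (@reply_outdeg _ _ _ _ _ _ _ v) // -/s1.
have st2 : step A W ([:: walk_test, walk & K], s1) =
   [:: (1, ((if outdeg e v == 0%N then WSet 13 (lit 0) else walk_coin) :: walk :: K, s1))].
  by rewrite /= W0 /upd.
apply: le_trans (lerD (lexx _) (lerD (lexx _) (lerD (lexx _)
   (value_det n_gt0 tau_ge0 g_ge0 m st2)))) _.
rewrite ppr_mean_first.
have S0 : 0 <= hop alpha e v * \sum_(w | e v w) ppr_mean F w.
  rewrite mulr_ge0 ?hop_ge0 //; apply: sumr_ge0 => w _.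
  by apply: sumr_ge0 => u _; rewrite mulr_ge0 // ppr_ge0.
have t10 : tau * 10 <= tau * (10 / alpha).
  rewrite ler_wpM2l // ler_pdivlMr //; move: alpha01; lra.
case: ifPn => [d0|d0].
  have := stopE s1 fr1 sv erefl.
  move=> h; rewrite /stop_prob d0 mul1r.
  move: t10 S0 h; set X := value _ _ _ _ _ _; set Y := hop _ _ _ * _.
  set T := tau * (10 / alpha) => h1 h2 h3; move: tau_ge0 => t0; lra.
have st3 : step A W ([:: walk_coin, walk & K], s1) =
   [:: (1, ([:: Flip 14 (RVar 0), walk_branch, walk & K], s1))] by [].
have := value_det n_gt0 tau_ge0 g_ge0 m st3.
have := @value_flip 14 (RVar 0) m [:: walk_branch, walk & K] s1.
rewrite /= ra (ltW alpha_gt0) (ltW (proj2 (andP alpha01))) => /(_ isT).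
set s2 := set_wvar s1 14 1; set s3 := set_wvar s1 14 0.
have fr2 : walk_frame s s2 by apply: walk_frame_trans fr1 _; exact: walk_frame_set.
have fr3 : walk_frame s s3 by apply: walk_frame_trans fr1 _; exact: walk_frame_set.
have st4 : step A W ([:: walk_branch, walk & K], s2) =
   [:: (1, ([:: WSet 13 (lit 0), walk & K], s2))] by rewrite /= W1.
have := value_det n_gt0 tau_ge0 g_ge0 m st4.
have := stopE s2 fr2 sv erefl.
have st5 : step A W ([:: walk_branch, walk & K], s3) =
   [:: (1, ([:: walk_move, walk & K], s3))] by rewrite /= W1.
have := value_det n_gt0 tau_ge0 g_ge0 m st5.
have st6 : step A W ([:: walk_move, walk & K], s3) =
   [:: (1, ([:: RandWord 12 (V 11), Query 10 (QOut (V 10) (V 12)), walk & K], s3))] by [].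
have := value_det n_gt0 tau_ge0 g_ge0 m st6.
have := @value_rand_word 12 (V 11) m [:: Query 10 (QOut (V 10) (V 12)), walk & K] s3.
have -> : weval W s3 (V 11) = outdeg e v by [].
rewrite lt0n => /(_ d0).
have next : \sum_(j < outdeg e v) val_ m [:: Query 10 (QOut (V 10) (V 12)), walk & K] (set_wvar s3 12 j)
   <= (outdeg e v)%:R * (tau + tau * (10 / alpha)) + \sum_(w | e v w) ppr_mean F w.
  have -> : \sum_(w | e v w) ppr_mean F w = \sum_(w <- outs A v) ppr_mean F w.
    by rewrite big_uniq ?outs_uniq //=; apply: eq_bigl => w; rewrite mem_outs.
  have szo : size (outs A v) = outdeg e v.
    rewrite -(card_uniqP (outs_uniq A v)) /outdeg cardsE.
    by apply: eq_card => u; rewrite mem_outs.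
  rewrite (big_nth v) szo big_mkord mulr_natl -[in X in _ <= X + _](card_ord (outdeg e v)) -sumr_const -big_split /=.
  apply: ler_sum => j _.
  apply: le_trans (value_final _ _ _ _) _ => //=.
  set w := nth v (outs A v) j.
  have -> : reply A W (set_wvar s3 12 j) (QOut (V 10) (V 12)) = w.
    rewrite /reply /= /upd /= sv valK /=.
    by rewrite (nth_map v) // szo.
  rewrite mulr1 -addrA lerD2l.
  apply: IH => //.
  move=> m' mm s' u fr; apply: FKm => //; apply: walk_frame_trans fr.
  by do 2 (apply: walk_frame_trans; last exact: walk_frame_set).
rewrite /stop_prob (negPf d0).
set X1 := val_ _ _ _; set X2 := val_ _ _ _; set X3 := val_ _ _ _.
move: next; set NX := \sum_(j < _) _ => next.
set X4 := val_ _ _ _; set X5 := val_ _ _ _; set X6 := val_ _ _ _.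
set X7 := val_ _ _ _; set S := \sum_(w | _) _ in next S0 *.
set T := tau * (10 / alpha) in next t10 *.
have d1 : (outdeg e v)%:R != 0 :> R by rewrite pnatr_eq0.
have {}next : (outdeg e v)%:R^-1 * NX <= tau + T + (outdeg e v)%:R^-1 * S.
  have -> : tau + T + (outdeg e v)%:R^-1 * S = (outdeg e v)%:R^-1 * ((outdeg e v)%:R * (tau + T) + S).
    by rewrite mulrDr mulKf.
  by rewrite ler_wpM2l // invr_ge0.
have aT : alpha * T = tau * 10 by rewrite /T; field; rewrite lt0r_neq0.
move=> x1 x2 x3 x4 x5 x6 x7.
have x3' : (1 - alpha) * X3 <= (1 - alpha) * (4 * tau + T) + hop alpha e v * S.
  rewrite /hop -mulrA -mulrDr ler_wpM2l //; first by move: alpha01; lra.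
  lra.
have x5' : alpha * X5 <= alpha * (3 * tau + F v) by rewrite ler_wpM2l ?(ltW alpha_gt0) //; lra.
have := mulr_ge0 (ltW alpha_gt0) tau_ge0; lra.
Qed.

Definition sample_mean (x : 'I_n -> R) : (R -> R) -> R -> R :=
  average (endpoint alpha e) (fun u => x u / stop_prob alpha e u).

Definition sample_frame (s s' : state R) (z : R) : Prop :=
  [/\ forall y, (y < 10)%N -> wvar s' y = wvar s y, warr s' = warr s,
      forall y, y != 5 -> y != 7 -> rvar s' y = rvar s y,
      rarr s' = rarr s & rvar s' 5 = z].

(** Here [j] is the number of samples still to draw. Averaging [ppr_mean] over a uniform start gives
    the [endpoint] average, so each sample applies [sample_mean] once; besides its walk it costs 11
    units. *)
Lemma value_samples x (F : R -> R) m K s N j :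
  rvar s 0 = alpha -> residue s x -> rvar s 2 = N -> rvar s 7 = N - j%:R ->
  (forall s' z, sample_frame s s' z -> val_ m K s' <= F z) ->
  val_ m (samples :: K) s <=
  tau * ((11 + 10 / alpha) * j%:R + 1) + iter j (sample_mean x) F (rvar s 5).
Proof.
elim: j s => [|j IH] s ra rx sN sj FK.
  rewrite mulr0 add0r mulr1 /=.
  have st : step A W (samples :: K, s) = [:: (1, (K, s))].
    by rewrite /= sN sj subr0 lexx.
  apply: le_trans (value_det n_gt0 tau_ge0 g_ge0 m st) _.
  by rewrite lerD2l; apply: FK.
have st : step A W (samples :: K, s) =
  [:: (1, ([:: Seq (Query 10 QRandVertex) (Seq (WSet 13 (lit 1)) (Seq walk record_sample)),
       samples & K], s))].
  by rewrite /= sN sj lerBrDr gerDl -ltNge ltr0Sn.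
apply: le_trans (value_det n_gt0 tau_ge0 g_ge0 m st) _.
have st1 : step A W ([:: Seq (Query 10 QRandVertex) (Seq (WSet 13 (lit 1)) (Seq walk record_sample)),
       samples & K], s) =
  [:: (1, ([:: Query 10 QRandVertex, Seq (WSet 13 (lit 1)) (Seq walk record_sample),
       samples & K], s))] by [].
have := value_det n_gt0 tau_ge0 g_ge0 m st1.
have := value_rand_vertex 10 m [:: Seq (WSet 13 (lit 1)) (Seq walk record_sample), samples & K] s.
set X1 := val_ _ _ _; set X2 := val_ _ _ _.
set G := fun u : 'I_n => tau * ((11 + 10 / alpha) * j%:R + 1) + tau * 5 +
    iter j (sample_mean x) F (rvar s 5 + x u / stop_prob alpha e u).
have vstep (v : 'I_n) : val_ m [:: Seq (WSet 13 (lit 1)) (Seq walk record_sample), samples & K]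
    (set_wvar s 10 v) <= tau * 3 + tau * (10 / alpha) + ppr_mean G v.
  have st2 : step A W ([:: Seq (WSet 13 (lit 1)) (Seq walk record_sample), samples & K],
      set_wvar s 10 v) =
    [:: (1, ([:: WSet 13 (lit 1), Seq walk record_sample, samples & K], set_wvar s 10 v))] by [].
  apply: le_trans (value_det n_gt0 tau_ge0 g_ge0 m st2) _.
  apply: le_trans (lerD (lexx _) (value_final _ _ _ _)) _ => //=.
  rewrite W1; set s1 := set_wvar _ _ _.
  have st3 : step A W ([:: Seq walk record_sample, samples & K], s1) =
    [:: (1, ([:: walk, record_sample, samples & K], s1))] by [].
  apply: le_trans (lerD (lexx _) (lerD (lexx _) (value_det n_gt0 tau_ge0 g_ge0 m st3))) _.
  suff h : val_ m [:: walk, record_sample, samples & K] s1 <= tau * (10 / alpha) + ppr_mean G v.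
    move: h; set X := val_ _ _ _; move: (ppr_mean _ _) => Y; lra.
  apply: value_walk => // s2 u [f1 f2 f3 f4] h10 h11.
  apply: le_trans (value_final _ _ _ _) _ => //.
  have -> : final A W record_sample s2 =
      set_rvar (set_rvar s2 5 (rvar s 5 + x u / stop_prob alpha e u)) 7 (N - j%:R).
    rewrite /= h11 W0 /stop_prob h10.
    have e5 : rvar s2 5 = rvar s 5 by rewrite f3.
    have e7 : rvar s2 7 = N - j.+1%:R by rewrite f3.
    have e0 : rvar s2 0 = alpha by rewrite f3.
    have ex : rarr s2 0 u = x u by rewrite f4; exact: rx.
    rewrite W1; case: ifP => _ /=; rewrite /upd /= e5 ?e0 e7 ex ?divr1;
      congr (set_rvar _ _ _); rewrite -natr1; ring.
  set s3 := set_rvar _ _ _.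
  have [] := (f3, f4) => {}f3 {}f4.
  have h := IH s3; have -> : (duration record_sample)%:R = 5 :> R by [].
  rewrite /G [X in _ <= X + _]addrC -addrA lerD2l; apply: h => //.
  - by rewrite /s3 /= f3.
  - by move=> w; rewrite /s3 /= f4; exact: rx.
  - by rewrite /s3 /= /upd /= f3.
  move=> s' z [k1 k2 k3 k4 k5]; apply: FK; split => //.
  - move=> y y10; rewrite k1 // /s3 /= f1 // /s1 /= /upd.
    by case: eqP => [?|_]; [lia|case: eqP => // ?; lia].
  - by rewrite k2 /s3 /= f2.
  - move=> y y5 y7; rewrite k3 // /s3 /= /upd (negPf y5) (negPf y7) f3 //.
  - by rewrite k4 /s3 /= f4.
move=> h1 h2.
have h3 : \sum_(v < n) val_ m [:: Seq (WSet 13 (lit 1)) (Seq walk record_sample), samples & K]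
    (set_wvar s 10 v) <= n%:R * (tau * 3 + tau * (10 / alpha)) + \sum_v ppr_mean G v.
  rewrite mulr_natl -[in X in _ <= X + _](card_ord n) -sumr_const -big_split /=.
  by apply: ler_sum => v _; exact: vstep.
have nz : n%:R != 0 :> R by rewrite pnatr_eq0 -lt0n.
have h4 : n%:R^-1 * \sum_v ppr_mean G v = tau * ((11 + 10 / alpha) * j%:R + 1) + tau * 5 +
     iter j.+1 (sample_mean x) F (rvar s 5).
  rewrite exchange_big /= /average.
  transitivity (\sum_u endpoint alpha e u * G u).
    rewrite mulr_sumr; apply: eq_bigr => u _.
    by rewrite -mulr_suml /endpoint mulrA [_^-1 * _]mulrC.
  rewrite /G; under eq_bigr => u _ do rewrite mulrDr.
  by rewrite big_split /= -mulr_suml (sum_endpoint e alpha01 (Ordinal n_gt0)) mul1r.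
have h5 := ler_wpM2l (_ : 0 <= n%:R^-1 :> R) h3.
have {}h5 : n%:R^-1 * \sum_(v < n) val_ m [:: Seq (WSet 13 (lit 1)) (Seq walk record_sample), samples & K]
    (set_wvar s 10 v) <= tau * 3 + tau * (10 / alpha) + (tau * ((11 + 10 / alpha) * j%:R + 1) + tau * 5 +
     iter j.+1 (sample_mean x) F (rvar s 5)).
  by rewrite -h4 -[X in _ <= X + _](mulKf nz) -mulrDr; apply: h5; rewrite invr_ge0.
move: h5 h1 h2; set Y := n%:R^-1 * _; move: (iter _ _ _ _) => Z h5 h1 h2.
rewrite -[j.+1%:R]natr1; move: tau_ge0 => t0; lra.
Qed.

End Sampling.

(** * The main loop *)

Lemma big_uniq_cond (T : Type) (idx : T) (op : Monoid.com_law idx) (I : finType)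
    (r : seq I) (P : pred I) (F : I -> T) : uniq r ->
  \big[op/idx]_(i <- r | P i) F i = \big[op/idx]_(i | (i \in r) && P i) F i.
Proof.
move=> ur; rewrite -big_filter big_uniq ?filter_uniq //=.
by apply: eq_bigl => i; rewrite mem_filter andbC.
Qed.

Section Invariant.
Variables (R : realType) (alpha : R) (n : nat) (e : rel 'I_n) (A : adjacency e).
Variables (W : nat) (tau : R) (g : R -> R) (t : 'I_n).
Hypotheses (alpha01 : 0 < alpha < 1) (tau_ge0 : 0 <= tau) (g_ge0 : forall x, 0 <= g x).
Hypotheses (n_gt0 : (0 < n)%N) (nW : (n < W)%N) (W_gt2 : (2 < W)%N).

Local Notation exec := (exec A W tau g).
Local Notation scalars := (scalars alpha n).

Let alpha_gt0 : 0 < alpha. Proof. by case/andP: alpha01. Qed.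

Lemma size_cover (L L0 S : seq 'I_n) : uniq L ->
  (forall u, u \in L -> (u \in L0) || has (e u) S) ->
  (size L <= size L0 + \sum_(v <- S) indeg e v)%N.
Proof.
move=> uL LS; pose B := L0 ++ flatten [seq ins A v | v <- S].
have -> : (size L0 + \sum_(v <- S) indeg e v)%N = size B.
  rewrite size_cat size_flatten /shape -map_comp sumnE big_map.
  by congr addn; apply: eq_bigr => v _; rewrite /= (size_ins A).
apply: uniq_leq_size => // u /LS /orP[uL0|/hasP[v vS euv]].
  by rewrite mem_cat uL0.
rewrite mem_cat; apply/orP; right; apply/flattenP; exists (ins A v).
  exact: map_f.
by rewrite mem_ins.
Qed.

Definition theta (M : R) : R := alpha * M / 2.

(** This weakens as [M] decreases, so it survives later rounds; it bounds the list, including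
    vertices touched long ago, by a sum over the current [V_theta]. *)
Definition covered (L : seq 'I_n) (M : R) : Prop :=
  forall u, u \in L -> u = t \/ exists2 v, e u v & theta M <= ppr alpha e v t.

Lemma Tsum_gt0 M : M <= 1 -> (0 < Tsum alpha e t (theta M))%N.
Proof.
move=> M1; rewrite /Tsum (bigD1 t) //=.
rewrite inE; apply: le_trans (ppr_self_ge e alpha01 t).
rewrite /theta; have := ler_wpM2l (ltW alpha_gt0) M1; move: alpha_gt0 => ?; lra.
Qed.

(** The list has at most [1 + Tsum] entries, hence at most twice [Tsum] because [t] lies in
    [V_theta]; the pushed vertices add at most [Tsum] because a residue never exceeds [ppr]. *)
Lemma cost_le_Tsum M (x : 'I_n -> R) L : M <= 1 -> uniq L ->
  (forall v, x v <= ppr alpha e v t) -> covered L M ->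
  (cost alpha e M x L <= 3 * Tsum alpha e t (theta M))%N.
Proof.
move=> M1 uL xp cL.
have h1 : (size L <= 1 + \sum_(v in Vset alpha e t (theta M)) indeg e v)%N.
  rewrite -big_enum /=; apply: (@size_cover L [:: t]) => // u /cL[->|[v euv tv]].
    by rewrite mem_head.
  by apply/orP; right; apply/hasP; exists v => //; rewrite mem_enum inE.
have h2 : (\sum_(v <- L | (alpha * M / 2 <= x v)%R) (1 + indeg e v) <=
   Tsum alpha e t (theta M))%N.
  rewrite /Tsum big_uniq_cond //= [X in (X <= _)%N]big_mkcond [X in (_ <= X)%N]big_mkcond.
  apply: leq_sum => v _; rewrite inE; case: andP => // -[_ vx].
  by rewrite (le_trans vx).
have h3 := Tsum_gt0 M1.
have h4 : (\sum_(v in Vset alpha e t (theta M)) indeg e v <= Tsum alpha e t (theta M))%N.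
  by rewrite /Tsum; apply: leq_sum => v _; exact: leq_addl.
apply: leq_trans (leq_add h1 h2) _; move: h3 h4.
by move: (Tsum _ _ _ _) (\sum_(v in _) indeg e v)%N => T S; lia.
Qed.

(** [size L <= N] lets the budget pay for the scan even when the push is refused. The factor 6 comes
    from doubling, which happens only when [N] is below a cost of at most 3 times [Tsum]. *)
Definition loop_inv (s : state R) (K : R) (N : nat) (M : R) : Prop :=
  exists L x p,
  [/\ [/\ scalars s K N%:R M, touched s L, residue s x & rvar s 4 = \sum_v p v],
      [/\ uniq L, (size L <= N)%N, forall v, x v != 0 -> v \in L & covered L M],
      [/\ forall v, 0 <= p v, forall v, 0 <= x v <= M
        & forall s0, ppr alpha e s0 t = p s0 + \sum_v visits alpha e s0 v * x v]
    & [/\ (0 < N)%N, (N <= 6 * Tsum alpha e t (theta M))%N & 0 < M <= 1]].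

(* One round either pushes, shrinking M, or doubles the budget. *)
Definition next_params (N : nat) (M : R) (N' : nat) (M' : R) : Prop :=
  (N' = N /\ M' = (1 - alpha / 2) * M) \/ (N' = (2 * N)%N /\ M' = M).

Lemma Tsum_antimono r r' : r <= r' -> (Tsum alpha e t r' <= Tsum alpha e t r)%N.
Proof.
move=> rr; rewrite /Tsum [X in (X <= _)%N]big_mkcond [X in (_ <= X)%N]big_mkcond.
by apply: leq_sum => v _; rewrite !inE; case: ifP => // h; rewrite (le_trans rr).
Qed.

(** An accepted push takes at most [12 N + 16 N + 16] units, whence 44. The new list consists of old
    vertices and in-neighbours of pushed ones, so its length is at most the cost, which restores
    [size L <= N]. *)
Lemma exec_adapt s K N M : loop_inv s K N M ->
  exists N' M', next_params N M N' M' /\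
    exec adapt s (44 * N')%N (fun s' => loop_inv s' K N' M').
Proof.
case=> L [x [p [[sc tL rx sP] [uL LN xL cL] [p0 xM pid] [N0 NT /andP[M0 M1]]]]].
have x0 v : 0 <= x v by case/andP: (xM v).
have xp := residue_le_ppr alpha01 p0 x0 pid.
have cT := cost_le_Tsum M1 uL xp cL.
have sz : (size L <= cost alpha e M x L)%N by exact: leq_addr.
have hscan := exec_scan A alpha01 tau_ge0 g_ge0 n_gt0 nW W_gt2 uL sc tL rx sP.
have cond (s1 : state R) b : rvar s1 6 = (cost alpha e M x L)%:R -> rvar s1 2 = N%:R ->
   b = beval W s1 (BRle (RVar 6) (RVar 2)) -> b = (cost alpha e M x L <= N)%N.
  by move=> /= -> -> ->; rewrite ler_nat.
case: (leqP (cost alpha e M x L) N) => cN; last first.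
  exists (2 * N)%N, M; split; first by right.
  apply: (exec_weaken tau_ge0 (k := (12 * size L + 5 + 2).+1)); last first.
  - by move=> s' h; exact: h.
  - by lia.
  apply: (exec_seq n_gt0 tau_ge0 g_ge0 hscan) => s1 [sc1 tL1 rx1 P1 [a1 c1]].
  have [h0 h6 ha hK [hb hM]] := sc1.
  apply: (exec_if n_gt0 tau_ge0 g_ge0).
  rewrite (cond s1 _ c1 hb erefl) leqNgt cN /=.
  apply: exec_straight => //; exists L, x, p; split => //.
  - split => //; split => //=; split => //=.
    by rewrite /upd /= hb natrM mulr_natl mulr2n.
  - by split => //; rewrite mul2n -addnn (leq_trans LN) // leq_addr.
  - by split; [lia|lia|rewrite M0].
exists N, ((1 - alpha / 2) * M); split; first by left.
have q1 : (1 - alpha / 2) * M = M - alpha * M / 2 by field.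
set M' := (1 - alpha / 2) * M in q1 *.
have M'0 : 0 < M' by rewrite mulr_gt0 //; move: alpha01; lra.
have M'M : M' <= M by rewrite q1 gerBl divr_ge0 // mulr_ge0 // ltW.
have thM : theta M' <= theta M.
  by rewrite /theta ler_wpM2r // ler_wpM2l // ltW.
apply: (exec_weaken tau_ge0 (k := (12 * size L + 5 + (16 * cost alpha e M x L + 9).+1).+1)); last first.
- by move=> s' h; exact: h.
- by move: LN cN N0; lia.
apply: (exec_seq n_gt0 tau_ge0 g_ge0 hscan) => s1 [sc1 tL1 rx1 P1 [a1 c1]].
have [h0 h6 ha hK [hb hM]] := sc1.
apply: (exec_if n_gt0 tau_ge0 g_ge0).
rewrite (cond s1 _ c1 hb erefl) cN.
have hpush := exec_push A alpha01 tau_ge0 g_ge0 n_gt0 nW W_gt2 uL x0 sc1 tL1 rx1 P1 a1.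
apply: (exec_weaken tau_ge0 hpush) => // s2 [L2 [uL2 mL2] [sc2 tL2 rx2 P2]].
set a := amount alpha M x in a1 mL2 rx2 P2.
have a0 v : 0 <= a v by rewrite /a /amount; case: ifP.
have aL v : v \notin L -> a v = 0.
  move=> vL; have xv : x v = 0 by apply/eqP; apply: contraNT vL; exact: xL.
  by rewrite /a /amount xv if_same.
have ax v : 0 < a v -> theta M <= x v.
  by rewrite /a /amount /theta; case: ifP => //; rewrite ltxx.
have sumL (Pr : pred 'I_n) : \sum_(v <- L | Pr v) a v = \sum_(v | Pr v) a v.
  rewrite big_uniq_cond //= [RHS](bigID (mem L)) /= [X in _ = _ + X]big1 ?addr0.
    by apply: eq_bigl => v; rewrite andbC.
  by move=> v /andP[_ /aL].
pose x2 u := x u - a u + hop alpha e u * \sum_(w | e u w) a w.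
have rx2' : residue s2 x2.
  by move=> u; rewrite rx2 !sumL big_pred1_eq.
exists L2, x2, (fun v => p v + a v); split.
- split => //; first by rewrite -q1 in sc2.
  by rewrite P2 sumL big_split.
- split => //.
  + apply: leq_trans cN; rewrite /cost.
    have h (S : seq 'I_n) : (\sum_(v <- S) indeg e v <= \sum_(v <- S) (1 + indeg e v))%N.
      by apply: leq_sum => v _; exact: leq_addl.
    rewrite -big_filter; apply: leq_trans (leq_add (leqnn _) (h _)).
    apply: size_cover => // u; rewrite mL2 => /orP[->//|/hasP[v vL /andP[av euv]]].
    apply/orP; right; apply/hasP; exists v => //.
    by rewrite mem_filter vL andbT; exact: ax.
  + move=> u; apply: contraNT; rewrite mL2 negb_or => /andP[uL' /hasPn nh].
    have xu : x u = 0 by apply/eqP; apply: contraNT uL'; exact: xL.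
    rewrite /x2 xu aL // subrr add0r -sumL big_seq_cond big1 ?mulr0 //.
    move=> v /andP[vL euv]; have := nh v vL; rewrite euv andbT -leNgt => av.
    by apply/eqP; rewrite eq_le av a0.
  + move=> u; rewrite mL2 => /orP[/cL[->|[v euv tv]]|/hasP[v vL /andP[av euv]]].
    * by left.
    * by right; exists v => //; exact: le_trans tv.
    * right; exists v => //; apply: le_trans (xp v).
      exact: le_trans thM (ax _ av).
- split.
  + by move=> v; rewrite addr_ge0.
  + by move=> v; exact: (push_contracts e alpha01 xM v).
  + exact: push_identity.
- split => //; last by rewrite M'0 (le_trans M'M).
  by apply: leq_trans NT _; rewrite leq_mul2l Tsum_antimono.
Qed.

End Invariant.

(** * One round of the main loop as a recurrence *)

Section MainLoop.
Variables (R : realType) (alpha : R) (n : nat) (e : rel 'I_n) (A : adjacency e).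
Variables (W : nat) (tau : R) (g : R -> R) (t : 'I_n).
Hypotheses (alpha01 : 0 < alpha < 1) (tau_ge0 : 0 <= tau) (g_ge0 : forall x, 0 <= g x).
Hypotheses (n_gt0 : (0 < n)%N) (nW : (n < W)%N) (W_gt2 : (2 < W)%N).

Local Notation exec := (exec A W tau g).
Local Notation val_ m K s := (value A W tau g m (K, s)).
Local Notation pi_t := (pagerank alpha e t).
Local Notation loop_inv := (loop_inv alpha e t).

Let alpha_gt0 : 0 < alpha. Proof. by case/andP: alpha01. Qed.
Let W0 : (0 %% W = 0)%N. Proof. by rewrite mod0n. Qed.
Let W1 : (1 %% W = 1)%N. Proof. by rewrite modn_small // ltnW. Qed.

(** The corrected sum has mean exactly [N * pi_t], so only the variance term remains. A sample lies
    between 0 and [M / alpha], so its second moment is at most [M / alpha] times its mean. *)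
Lemma sample_quadratic M (x p : 'I_n -> R) N c0 c2 :
  0 <= c2 -> (forall v, 0 <= p v) -> (forall v, 0 <= x v <= M) ->
  (forall s, ppr alpha e s t = p s + \sum_v visits alpha e s v * x v) ->
  iter N (sample_mean alpha e x) (fun z => c0 + c2 * (z - N%:R * pi_t) ^+ 2)
    (N%:R * (\sum_v p v) / n%:R) <= c0 + c2 * (N%:R * (M / alpha * pi_t)).
Proof.
move=> c20 p0 xM pid.
have mu0 := endpoint_ge0 e alpha01.
have mu1 := sum_endpoint e alpha01 t.
have my := mean_sample alpha01 pid.
set P := (\sum_s p s) in my *.
set y := fun u => x u / stop_prob alpha e u.
have P0 : 0 <= P / n%:R by rewrite divr_ge0 // sumr_ge0.
have y0 u : 0 <= y u by rewrite divr_ge0 //; [case/andP: (xM u)|exact/ltW/stop_prob_gt0].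
have yM u : y u <= M / alpha.
  case/andP: (xM u) => x0 x1; rewrite ler_pM //.
    by rewrite invr_ge0 ltW // stop_prob_gt0.
  by rewrite lef_pV2 ?stop_prob_ge // posrE // stop_prob_gt0.
have vy : \sum_u endpoint alpha e u * (y u - (pi_t - P / n%:R)) ^+ 2 <= M / alpha * pi_t.
  have -> : \sum_u endpoint alpha e u * (y u - (pi_t - P / n%:R)) ^+ 2 =
    \sum_u (endpoint alpha e u * y u * y u - 2 * (pi_t - P / n%:R) * (endpoint alpha e u * y u)
      + endpoint alpha e u * (pi_t - P / n%:R) ^+ 2).
    by apply: eq_bigr => u _; ring.
  rewrite big_split sumrB /= -mulr_sumr -mulr_suml my mu1.
  have h : \sum_u endpoint alpha e u * y u * y u <= (pi_t - P / n%:R) * (M / alpha).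
    rewrite -my mulr_suml; apply: ler_sum => u _.
    by rewrite ler_wpM2l // mulr_ge0.
  have Ma : 0 <= M / alpha by exact: le_trans (y0 t) (yM t).
  have h2 : (pi_t - P / n%:R) * (M / alpha) <= M / alpha * pi_t.
    by rewrite mulrC ler_wpM2l // gerBl.
  have := sqr_ge0 (pi_t - P / n%:R).
  move: h h2; set D := pi_t - _; set S := \sum_u _; lra.
apply: le_trans (iter_average_quadratic mu0 mu1 c0 (N%:R * pi_t) N (N%:R * P / n%:R) c20 my vy) _.
by rewrite mulrBr (_ : _ - _ = 0); [rewrite expr0n add0r|ring].
Qed.

Lemma loop_inv_frame s s' z K N M : sample_frame s s' z -> loop_inv s K N M ->
  loop_inv s' K N M.
Proof.
case=> k1 k2 k3 k4 k5 [L [x [p [[[h0 h6 ha hK [hb hM]] [t1 t2 t3] rx sP] u v w]]]].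
exists L, x, p; split => //; split.
- by rewrite /scalars !k1 // !k3.
- by rewrite /touched k1 // k2.
- by rewrite /residue k4.
- by rewrite k3.
Qed.

(** Chebyshev's inequality in a reusable form: the payoff of a round, as a function of the corrected
    sum [z], may be majorized by any quadratic centred at its mean. Choosing [Bnd], [c0] and [c2]
    gives both the error recurrence and the time recurrence. *)
Lemma value_main K s N M m : loop_inv s K N M ->
  exists N' M', [/\ next_params alpha N M N' M', (0 < N')%N, 0 < M' <= 1,
    (N' <= 6 * Tsum alpha e t (theta alpha M'))%N &
    forall Bnd c0 c2, 0 <= c2 ->
    (forall s', loop_inv s' K N' M' -> val_ m [:: main_loop] s' <= Bnd) ->
    (forall z, (if K * M' <= z then g (z / N'%:R) else Bnd) <=
       c0 + c2 * (z - N'%:R * pi_t) ^+ 2) ->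
    val_ m.+1 [:: main_loop] s <=
    tau * ((69 + 10 / alpha) * N'%:R) + c0 + c2 * (N'%:R * (M' / alpha * pi_t))].
Proof.
move=> inv.
have [N' [M' [nxt ex]]] := exec_adapt A alpha01 tau_ge0 g_ge0 n_gt0 nW W_gt2 inv.
have w6 : wvar s 6 = 0%N by case: inv => L [x [p [[[]]]]].
case: ex => s1 inv1 h1.
have [L [x [p [[sc tL rx sP] [uL LN xL cL] [p0 xM pid] [N0 NT M0]]]]] := inv1.
exists N', M'; split => // Bnd c0 c2 c20 hB hz.
rewrite value_stepS //= w6 W0 eqxx big_seq1 mul1r -/main_loop.
pose rest := Seq sample_pre (Seq samples finish).
have st1 : step A W ([:: Seq adapt rest; main_loop], s) =
   [:: (1, ([:: adapt; rest; main_loop], s))] by [].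
have q1 := value_det n_gt0 tau_ge0 g_ge0 m st1.
have q2 := h1 m [:: rest; main_loop].
have st3 : step A W ([:: rest; main_loop], s1) =
   [:: (1, ([:: sample_pre; Seq samples finish; main_loop], s1))] by [].
have q3 := value_det n_gt0 tau_ge0 g_ge0 m st3.
have q4 : val_ m [:: sample_pre; Seq samples finish; main_loop] s1 <= _ :=
  @value_final _ _ _ A W tau g tau_ge0 g_ge0 n_gt0 sample_pre m [:: Seq samples finish; main_loop] s1 isT.
set s2 := final A W sample_pre s1 in q4.
have q4' : (duration sample_pre)%:R = 3 :> R by [].
rewrite {}q4' in q4.
have st5 : step A W ([:: Seq samples finish; main_loop], s2) =
   [:: (1, ([:: samples; finish; main_loop], s2))] by [].
have q5 := value_det n_gt0 tau_ge0 g_ge0 m st5.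
have [h0 h6 ha hK [hb hM]] := sc.
have e5 : rvar s2 5 = N'%:R * (\sum_v p v) / n%:R.
  by rewrite /s2 /= /upd /= hb sP h0.
pose F z := tau * 6 + c0 + c2 * (z - N'%:R * pi_t) ^+ 2.
have inv2 : loop_inv s2 K N' M'.
  apply: (@loop_inv_frame s1 s2 (rvar s2 5)) inv1; split => //.
  by move=> y /negPf y5 /negPf y7; rewrite /s2 /= /upd y7 y5.
have q6 : val_ m [:: samples; finish; main_loop] s2 <=
   tau * ((11 + 10 / alpha) * N'%:R + 1) + iter N' (sample_mean alpha e x) F (rvar s2 5).
  apply: (@value_samples _ alpha n e A W tau g alpha01 tau_ge0 g_ge0 n_gt0 nW W_gt2 x F m _ s2 N'%:R N') => //.
  - by rewrite /s2 /= /upd /= W0 subrr.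
  move=> s' z fr; have [k1 k2 k3 k4 k5] := fr.
  have inv' := loop_inv_frame fr inv2.
  apply: le_trans (value_final A W tau_ge0 g_ge0 n_gt0 _ _ _ _) _ => //.
  have -> : (duration finish)%:R = 5 :> R by [].
  have := hz z.
  have -> : final A W finish s' = if K * M' <= z then
     set_wvar (set_rvar s' 0 (z / N'%:R)) 6 1 else s'.
    rewrite /= W1 k5 !k3 //.
    have -> : rvar s2 1 = K by rewrite /s2 /= /upd.
    have -> : rvar s2 2 = N'%:R by rewrite /s2 /= /upd.
    by have -> : rvar s2 3 = M' by rewrite /s2 /= /upd.
  case: ifP => _ hz'; last first.
    have := hB _ inv'; rewrite /F; move: (c2 * _) hz' => q hz'.
    set X := val_ _ _ _ => hX; move: tau_ge0 => t0; lra.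
  set s3 := set_wvar _ _ _.
  have st7 : step A W ([:: main_loop], s3) = [:: (1, ([::], s3))].
    by rewrite /= W0.
  have := value_det n_gt0 tau_ge0 g_ge0 m st7.
  have : val_ m [::] s3 <= g (z / N'%:R) by case: m {hB q1 q2 q3 q4 q5} => //=.
  rewrite /F; move: (c2 * _) hz' => q; set X := val_ _ _ _; set Y := val_ _ _ _.
  move: tau_ge0 => t0 *; lra.
have q7 := sample_quadratic N' (tau * 6 + c0) c20 p0 xM pid.
rewrite -e5 in q7.
(* [69 = 44 + 11 + 14]: the fixed overhead of 14 is absorbed by [1 <= N']. *)
have q8 : tau * (44 * N'%:R) + tau * (14 + ((11 + 10 / alpha) * N'%:R)) <=
   tau * ((69 + 10 / alpha) * N'%:R).
  rewrite -mulrDr ler_wpM2l //.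
  have : (1 : R) <= N'%:R by rewrite ler1n.
  move: (N'%:R) => q; set q' := 10 / alpha; lra.
rewrite natrM in q2.
move: q1 q2 q3 q4 q5 q6 q7 q8; rewrite /F /rest.
set X1 := val_ _ _ _; set X2 := val_ _ _ _; set X3 := val_ _ _ _; set X4 := val_ _ _ _;
set X5 := val_ _ _ _; set X6 := val_ _ _ _; set X7 := iter _ _ _ _.
rewrite -/rest.
set Y := c2 * _.
move: tau_ge0 => t0; lra.
Qed.

End MainLoop.

(** * Computing the scale [K] and establishing the invariant *)

Section Initialization.
Variables (R : realType) (alpha : R) (n : nat) (e : rel 'I_n) (A : adjacency e).
Variables (W : nat) (tau : R) (g : R -> R) (t : 'I_n).
Hypotheses (alpha01 : 0 < alpha < 1) (tau_ge0 : 0 <= tau) (g_ge0 : forall x, 0 <= g x).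
Hypotheses (n_gt0 : (0 < n)%N) (nW : (n < W)%N) (W_gt2 : (2 < W)%N).

Local Notation exec := (exec A W tau g).
Local Notation val_ m K s := (value A W tau g m (K, s)).

Let W0 : (0 %% W = 0)%N. Proof. by rewrite mod0n. Qed.
Let W1 : (1 %% W = 1)%N. Proof. by rewrite modn_small // ltnW. Qed.

Definition scale_post (c : nat) (s s' : state R) (j : nat) : Prop :=
  [/\ wvar s' = wvar s, warr s' = warr s, rarr s' = rarr s,
      rvar s' 1 = (c * j)%:R & forall y, y != 1%N -> y != 8 -> rvar s' y = rvar s y].

Lemma exec_set_scale c s : (c < W)%N -> wvar s 0 = n -> rvar s 1 = 0 ->
  exec (set_scale c) s (5 * (trunc_log 2 n).+1 + 3)%N
    (fun s' => scale_post c s s' (trunc_log 2 n).+1).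
Proof.
move=> cW s0 s1; set l := (trunc_log 2 n).+1.
pose Inv j s' := scale_post c s s' j /\ rvar s' 8 = (2 ^ j)%:R.
rewrite /set_scale; set wl := While _ _.
have loop j : (j <= l)%N -> forall s', Inv (l - j)%N s' ->
    exec wl s' (5 * j + 1)%N (fun s' => scale_post c s s' l).
  elim: j => [|j IH] jl s' [p8 r8].
    rewrite subn0 in p8 r8; apply: exec_while_exit => //=.
    case: p8 => -> _ _ _ _; rewrite r8 s0 ler_nat -ltnNge.
    exact: trunc_log_ltn.
  apply: (exec_weaken tau_ge0 (k := (3 + (5 * j + 1)).+1)); last first.
  - by move=> s2 h; exact: h.
  - by lia.
  apply: (exec_while_loop n_gt0 tau_ge0 g_ge0 (Q1 := Inv (l - j)%N)).
  - case: p8 => /= -> _ _ _ _; rewrite r8 s0 ler_nat.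
    apply: (@leq_trans (2 ^ trunc_log 2 n)); last by rewrite trunc_logP.
    by rewrite leq_exp2l // /l subSS leq_subr.
  - have -> : 3%N = duration (Seq (RSet 8 (RAdd (RVar 8) (RVar 8))) (RSet 1 (RAdd (RVar 1) (RWord (lit c))))) by [].
    have ej : (l - j = (l - j.+1).+1)%N by rewrite subnSK.
    apply: exec_straight => //=; rewrite ej; case: p8 => h1 h2 h3 h4 h5.
    split; last by rewrite /upd /= r8 expnS mul2n -addnn natrD.
    split => //=; first by rewrite /upd /= h4 modn_small // mulnS addnC natrD.
    by move=> y y1 y8; rewrite /upd (negPf y1) (negPf y8) h5.
  - by move=> s2 I2; apply: IH => //; exact: ltnW.
apply: (exec_weaken tau_ge0 (k := (1 + (5 * l + 1)).+1)); last first.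
- by move=> s2 h; exact: h.
- by lia.
apply: (exec_seq n_gt0 tau_ge0 g_ge0 (Q1 := Inv 0%N)).
  have := @exec_straight _ _ _ A W tau g n_gt0 tau_ge0 g_ge0 (RSet 8 (RWord (lit 1))) s (Inv 0%N).
  apply => //=; split; last by rewrite /upd /= W1.
  by split => //=; [rewrite /upd /= muln0|move=> y y1 y8; rewrite /upd (negPf y8)].
by move=> s2 I2; apply: loop => //; rewrite subnn.
Qed.

Lemma exec_start s K : wvar s 0 = n -> wvar s 1 = t -> wvar s 6 = 0%N ->
  warr s 1 =1 (fun=> 0%N) -> rarr s 0 =1 (fun=> 0) ->
  rvar s 0 = alpha -> rvar s 1 = K -> rvar s 4 = 0 ->
  exec start s (duration start) (fun s' => loop_inv alpha e t s' K 1 1).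
Proof.
move=> s0 s1 s6 m0 x0 ra rK r4.
apply: exec_straight => //.
pose x v : R := if v == t then stop_prob alpha e t else 0.
have x0' v : 0 <= x v by rewrite /x; case: ifP => // _; exact/ltW/stop_prob_gt0.
rewrite [final _ _ _ _]/= (@reply_outdeg _ _ _ _ _ _ _ t) //= W1 W0 /upd /=.
rewrite s1.
set s' := set_rvar _ _ _.
exists [:: t], x, (fun=> 0); split.
- split.
  + rewrite /scalars /s'; case: ifP => _ /=; rewrite /upd /=; split => //.
  + have mt (v : 'I_n) : (if val v == t then 1%N else warr s 1 v) = (v \in [:: t]).
      by rewrite inE val_eqE; case: eqP => // _; exact: m0.
    by rewrite /touched /s'; case: ifP => _ /=; rewrite /upd /=; split => // -[].
  + move=> v; rewrite /s' /x /stop_prob; case: ifP => _ /=; rewrite /upd /= val_eqE ?ra;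
     by case: eqP => // _; exact: x0.
  + by rewrite /s' big1 //; case: ifP.
- split => //.
  + by move=> v; rewrite /x inE; case: ifP => //; rewrite eqxx.
  + by move=> u; rewrite inE => /eqP ->; left.
- split => //.
  + move=> v; rewrite x0' /x; case: ifP => _; rewrite ?ler01 //.
    exact: stop_prob_le1.
  + move=> s2; rewrite add0r pprE // (bigD1 t) //= big1 ?addr0.
      by rewrite /x eqxx.
    by move=> v vt; rewrite /x (negPf vt) mulr0.
- split => //; last by rewrite ltr01 lexx.
  by apply: leq_trans (Tsum_gt0 e t alpha01 (lexx 1)) _; rewrite leq_pmull.
Qed.

Lemma value_program c : (c < W)%N ->
  exists2 s, loop_inv alpha e t s (c * (trunc_log 2 n).+1)%:R 1 1 &
  forall m, val_ m [:: program c] (init_state alpha t) <=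
    tau * (40 * (trunc_log 2 n).+1)%:R + val_ m [:: main_loop] s.
Proof.
move=> cW.
have [s1 [h1 h2 h3 h4 h5] k1] := @exec_set_scale c (init_state alpha t) cW erefl erefl.
have [s2 inv k2] : exec start s1 (duration start)
   (fun s' => loop_inv alpha e t s' (c * (trunc_log 2 n).+1)%:R 1 1).
  by apply: exec_start => //; rewrite ?h1 ?h2 ?h3 ?h5.
exists s2 => // m.
set s0 := init_state alpha t in k1 *.
have st1 : step A W ([:: program c], s0) =
  [:: (1, ([:: set_scale c; Seq start main_loop], s0))] by [].
have q1 := value_det n_gt0 tau_ge0 g_ge0 m st1.
have st2 : step A W ([:: Seq start main_loop], s1) =
  [:: (1, ([:: start; main_loop], s1))] by [].
have q2 := value_det n_gt0 tau_ge0 g_ge0 m st2.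
have q3 := k1 m [:: Seq start main_loop].
have q4 := k2 m [:: main_loop].
apply: le_trans q1 _; apply: le_trans (lerD (lexx _) q3) _.
apply: le_trans (lerD (lexx _) (lerD (lexx _) q2)) _.
apply: le_trans (lerD (lexx _) (lerD (lexx _) (lerD (lexx _) q4))) _.
rewrite !addrA lerD2r.
have -> : duration start = 15%N by [].
have : ((5 * (trunc_log 2 n).+1 + 3 + 17)%:R <= (40 * (trunc_log 2 n).+1)%:R :> R).
  by rewrite ler_nat; lia.
move=> /(ler_wpM2l tau_ge0); rewrite natrD; lra.
Qed.

End Initialization.

(** * From finite horizons to output probability and expected time *)

Section Outcome.
Variables (R : realType) (alpha : R) (n : nat) (e : rel 'I_n) (A : adjacency e).
Variables (kappa : nat) (P : cmd) (t : 'I_n).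
Hypothesis n_gt0 : (0 < n)%N.

Local Notation c_init := ([:: P], init_state alpha t).
Local Notation W := (word_bound n kappa).

Lemma nneseries_le (u : nat -> R) (B : R) : (forall k, 0 <= u k) ->
  (forall m, \sum_(k < m) u k <= B) -> (\sum_(0 <= k <oo) (u k)%:E <= B%:E)%E.
Proof.
move=> u0 uB; apply: lime_le.
  by apply: is_cvg_nneseries => k _ _; rewrite lee_fin.
by near=> m; rewrite sumEFin lee_fin big_mkord.
Unshelve. all: by end_near.
Qed.

Lemma nneseries_ge (u : nat -> R) m : (forall k, 0 <= u k) ->
  ((\sum_(k < m) u k)%:E <= \sum_(0 <= k <oo) (u k)%:E)%E.
Proof.
move=> u0; rewrite -(big_mkord xpredT u) -sumEFin.
by apply: nneseries_lim_ge => k _ _; rewrite lee_fin.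
Qed.

Lemma halts_split (E : R -> bool) k (c : config R) :
  halts A W xpredT k c = halts A W E k c + halts A W (fun x => ~~ E x) k c.
Proof.
rewrite !haltsE -big_split /=; apply: eq_bigr => p _; rewrite -mulrDr.
by case: (halted _); case: (E _); rewrite /= ?addr0 ?add0r.
Qed.

(* A uniform bound on the truncated expected time forces termination with
   probability one, so that a bound on the bad outputs bounds the good ones. *)
Lemma outcome_bounds (E : R -> bool) (B delta : R) :
  (forall m, value A W 1 (fun=> 0) m c_init <= B) ->
  (forall m, value A W 0 (fun x => (~~ E x)%:R) m c_init <= delta) ->
  ((1 - delta)%:E <= output_prob alpha A kappa P t E)%E /\
  (expected_time alpha A kappa P t <= B%:E)%E.
Proof.
move=> hB hd.
have h0 (E' : R -> bool) k (c : config R) : 0 <= halts A W E' k c := halts_ge0 A W n_gt0 E' k c.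
have timeE m : \sum_(k < m) k%:R * halts A W xpredT k c_init <= B /\
    m%:R * (1 - \sum_(k < m) halts A W xpredT k c_init) <= B.
  have := hB m; rewrite value_time //.
  have a : 0 <= \sum_(k < m) k%:R * halts A W xpredT k c_init.
    by apply: sumr_ge0 => k _; apply: mulr_ge0 => //; exact: h0.
  have b : 0 <= m%:R * (1 - \sum_(k < m) halts A W xpredT k c_init).
    by apply: mulr_ge0 => //; rewrite subr_ge0 sum_halts_le1.
  by move=> c; split; lra.
(* Markov's inequality: the computation outlasts [m] steps with probability at most [B / m], made
   smaller than any [eps] by [m > B / eps]. *)
have lower E' d : (forall m, \sum_(k < m) halts A W (fun x => ~~ E' x) k c_init <= d) ->
    ((1 - d)%:E <= output_prob alpha A kappa P t E')%E.
  move=> hd'; apply/lee_subgt0Pr => eps eps0.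
  have B0 : 0 <= B by have [] := timeE 0%N; rewrite big_ord0.
  pose m := (Num.truncn (B / eps)).+1.
  have mB : B / m%:R <= eps.
    rewrite ler_pdivrMr // mulrC -ler_pdivrMr //; apply/ltW.
    exact: truncnS_gt.
  have ge : ((\sum_(k < m) halts A W E' k c_init)%:E <= output_prob alpha A kappa P t E')%E.
    exact: (@nneseries_ge (fun k => halts A W E' k c_init) m (fun k => h0 E' k c_init)).
  apply: le_trans ge.
  rewrite -EFinB lee_fin.
  have [_ h1] := timeE m; have h2 := hd' m.
  have h3 : 1 - \sum_(k < m) halts A W xpredT k c_init <= B / m%:R.
    by rewrite ler_pdivlMr // mulrC.
  have h4 : \sum_(k < m) halts A W xpredT k c_init = \sum_(k < m) halts A W E' k c_init +
     \sum_(k < m) halts A W (fun x => ~~ E' x) k c_init.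
    by rewrite -big_split /=; apply: eq_bigr => k _; exact: halts_split.
  lra.
split; first by apply: lower => m; rewrite -value_prob.
have total : output_prob alpha A kappa P t xpredT = 1%E.
  apply/eqP; rewrite eq_le; apply/andP; split.
    by apply: nneseries_le => [k|m]; [exact: h0|exact: sum_halts_le1].
  rewrite -[X in (X%:E <= _)%E](subr0 1); apply: lower => m.
  rewrite big1 // => k _; rewrite haltsE big1 // => p _; by rewrite andbF mulr0.
rewrite /expected_time total eqxx; apply: nneseries_le => [k|m].
  by apply: mulr_ge0 => //; exact: h0.
by have [] := timeE m.
Qed.

End Outcome.

(** * Potentials *)

Section RealInequalities.
Variables (R : realType) (alpha : R).
Hypothesis alpha01 : 0 < alpha < 1.

Let alpha_gt0 : 0 < alpha. Proof. by case/andP: alpha01. Qed.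
Let alpha_lt1 : alpha < 1. Proof. by case/andP: alpha01. Qed.

(** With [u = 1 + rho'] and [y = alpha * rho'], the claim reduces to [(2 u + y) (u - y / 2) = 2 u ^+
    2 - y ^+ 2 / 2 <= 2 u ^+ 2]. *)
Lemma error_potential_step (rho rho' : R) : 0 < rho -> rho <= (1 - alpha / 2) * rho' ->
  2 / (1 + rho') + alpha * rho' / (1 + rho') ^+ 2 <= 2 / (1 + rho).
Proof.
move=> r0 rr.
have r'0 : 0 < rho'.
  have : 0 < (1 - alpha / 2) * rho' by exact: lt_le_trans rr.
  by rewrite pmulr_rgt0 //; move: alpha01; lra.
have u0 : 0 < 1 + rho' by lra.
rewrite ler_pdivlMr; last by lra.
have -> : (2 / (1 + rho') + alpha * rho' / (1 + rho') ^+ 2) * (1 + rho) =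
   (2 * (1 + rho') + alpha * rho') * (1 + rho) / (1 + rho') ^+ 2.
  by field; rewrite lt0r_neq0.
rewrite ler_pdivrMr ?exprn_gt0 //.
have a0 : 0 <= 2 * (1 + rho') + alpha * rho' by have := mulr_gt0 alpha_gt0 r'0; lra.
apply: le_trans (_ : (2 * (1 + rho') + alpha * rho') * (1 + rho' - alpha * rho' / 2) <= _).
  by rewrite ler_wpM2l //; lra.
have := sqr_ge0 (alpha * rho'); move: (alpha * rho') => y; nra.
Qed.

(** A bad halting sum is off by [eps * w]; and if the halting bound [u] exceeds [2 w], then merely
    reaching it is a deviation of more than [u / 2]. Having [u + w] instead of [w] makes premature
    halts in early rounds summable. *)
Lemma outlier_deviation (eps u w z : R) : 0 < eps <= 1 -> 0 < u -> 0 < w -> u <= z ->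
  ~~ ((1 - eps) * w <= z <= (1 + eps) * w) ->
  1 <= 16 / (eps * (u + w)) ^+ 2 * (z - w) ^+ 2.
Proof.
case/andP=> e0 e1 u0 w0 uz out.
have ew := mulr_gt0 e0 w0; have eu := mulr_gt0 e0 u0.
have h : eps * (u + w) / 4 <= `|z - w|.
  have out' : eps * w <= `|z - w|.
    move: out; rewrite negb_and -!ltNge => /orP[h|h].
      by rewrite ler0_norm; lra.
    by rewrite ger0_norm; lra.
  case: (lerP u (2 * w)) => uw.
    have := ler_wpM2l (ltW e0) uw; lra.
  rewrite ger0_norm; last by lra.
  have : eps * u <= u by rewrite ler_piMl // ltW.
  have : eps * w <= w by rewrite ler_piMl // ltW.
  lra.
have d0 : 0 < eps * (u + w) by rewrite mulr_gt0 // addr_gt0.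
have h2 : (eps * (u + w) / 4) ^+ 2 <= (z - w) ^+ 2.
  rewrite -[leRHS]real_normK ?num_real //.
  by rewrite lerXn2r // nnegrE // divr_ge0 // ltW.
rewrite mulrAC ler_pdivlMr ?exprn_gt0 // mul1r.
move: h2; rewrite expr_div_n; lra.
Qed.

Variables (X K C : R).
Hypotheses (X_ge0 : 0 <= X) (K_gt0 : 0 < K) (C_gt0 : 0 < C).

(** Here [y] is the budget. The logarithm pays [6 X] in each of the rounds before [rho] reaches 2;
    the term linear in [rho] pays [rho K X], a geometric sum. The constants 4 and 5, rather than 2,
    leave a reserve for the round that crosses 2. *)
Definition time_potential (y rho : R) : R :=
  if 2 <= rho then 4 * C * y
  else 12 * C * (2 / alpha) * X * ln (4 / rho) + 6 * C / alpha ^+ 2 * K * X * (5 - rho).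

Let XC : 0 <= C * X. Proof. by rewrite mulr_ge0 // ltW. Qed.
Let CKXa : 0 <= C * K * X / alpha.
Proof. by rewrite divr_ge0 ?(ltW alpha_gt0) // mulr_ge0 // mulr_ge0 // ltW. Qed.

Lemma ln_ge_sub (x : R) : 0 < x -> 1 - x <= - ln x.
Proof.
move=> x0; have := @le_ln1Dx R (x - 1); have -> : 1 + (x - 1) = x by ring.
move=> h; have {h} : ln x <= x - 1 by apply: h; lra.
lra.
Qed.

Lemma time_potential_low y rho : 0 < rho -> rho < 2 ->
  12 * C * X + 18 * C * K * X / alpha <= time_potential y rho.
Proof.
move=> r0 r2; rewrite /time_potential (lt_geF r2).
have l : 1 / 2 <= ln (4 / rho).
  have := @ln_ge_sub (rho / 4); rewrite -lnV ?posrE ?divr_gt0 // invf_div => /(_ isT); lra.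
apply: lerD.
  have -> : 12 * C * X = 12 * C * (2 / alpha) * X * (alpha / 2).
    by field; rewrite lt0r_neq0.
  apply: ler_wpM2l; last by move: l alpha_lt1; lra.
  by rewrite mulr_ge0 // mulr_ge0 ?divr_ge0 ?(ltW alpha_gt0) // mulr_ge0 // ltW.
have -> : 18 * C * K * X / alpha = (C * K * X / alpha) * 18 by field; rewrite lt0r_neq0.
have -> : 6 * C / alpha ^+ 2 * K * X * (5 - rho) = (C * K * X / alpha) * (6 * (5 - rho) / alpha).
  by field; rewrite lt0r_neq0.
apply: ler_wpM2l => //; rewrite ler_pdivlMr //; move: alpha_lt1; lra.
Qed.

Lemma time_potential_ge0 y rho : 0 <= y -> 0 < rho -> 0 <= time_potential y rho.
Proof.
move=> y0 r0; case: (ltrP rho 2) => r2.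
  apply: le_trans (time_potential_low y r0 r2).
  have -> : 12 * C * X + 18 * C * K * X / alpha = 12 * (C * X) + 18 * (C * K * X / alpha).
    by field; rewrite lt0r_neq0.
  by rewrite addr_ge0 // mulr_ge0.
by rewrite /time_potential r2 mulr_ge0 // mulr_ge0 // ltW.
Qed.

(** As [- ln x >= 1 - x], a growth of [rho] by [1 / (1 - alpha / 2)] lowers [ln (4 / rho)] by at
    least [alpha / 2], and [5 - rho] falls by at least [alpha * rho' / 2]. *)
Lemma time_potential_step y y' rho rho' : 0 < rho -> rho <= (1 - alpha / 2) * rho' ->
  rho' < 2 -> y' <= 6 * X + 2 * K / alpha * rho' * X ->
  C * y' + time_potential y' rho' <= time_potential y rho.
Proof.
move=> r0 rr r2 yb.
have r'0 : 0 < rho'.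
  have : 0 < (1 - alpha / 2) * rho' by exact: lt_le_trans rr.
  by rewrite pmulr_rgt0 //; move: alpha01; lra.
have ar := mulr_gt0 alpha_gt0 r'0.
have r2' : rho < 2 by lra.
rewrite /time_potential (lt_geF r2) (lt_geF r2').
have l : ln (4 / rho') + alpha / 2 <= ln (4 / rho).
  have q0 : 0 < rho / rho' by rewrite divr_gt0.
  have := ln_ge_sub q0.
  have -> : 4 / rho = (4 / rho') * (rho / rho')^-1 by field; rewrite !lt0r_neq0.
  rewrite [ln (_ * (rho / rho')^-1)]lnM ?posrE ?invr_gt0 ?divr_gt0 // [ln (rho / rho')^-1]lnV ?posrE //.
  have : rho / rho' <= 1 - alpha / 2 by rewrite ler_pdivrMr.
  lra.
have l2 : 12 * C * (2 / alpha) * X * ln (4 / rho') + 12 * (C * X) <=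
   12 * C * (2 / alpha) * X * ln (4 / rho).
  have -> : 12 * (C * X) = 12 * C * (2 / alpha) * X * (alpha / 2).
    by field; rewrite lt0r_neq0.
  rewrite -mulrDr; apply: ler_wpM2l => //.
  by rewrite mulr_ge0 // mulr_ge0 ?divr_ge0 ?(ltW alpha_gt0) // mulr_ge0 // ltW.
have l3 : 6 * C / alpha ^+ 2 * K * X * (5 - rho') + (C * K * X / alpha) * (3 * rho') <=
   6 * C / alpha ^+ 2 * K * X * (5 - rho).
  have e1 z : 6 * C / alpha ^+ 2 * K * X * (5 - z) = (C * K * X / alpha) * (6 * (5 - z) / alpha).
    by field; rewrite lt0r_neq0.
  rewrite !e1 -mulrDr; apply: ler_wpM2l => //.
  rewrite ler_pdivlMr // mulrDl divfK ?lt0r_neq0 //; lra.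
have l4 : C * y' <= 6 * (C * X) + (C * K * X / alpha) * (2 * rho').
  have -> : 6 * (C * X) + (C * K * X / alpha) * (2 * rho') =
     C * (6 * X + 2 * K / alpha * rho' * X) by field; rewrite lt0r_neq0.
  by rewrite ler_wpM2l // ltW.
have l5 : 0 <= (C * K * X / alpha) * rho' by rewrite mulr_ge0 // ltW.
move: l2 l3 l4 l5 XC.
move: (12 * C * (2 / alpha) * X * ln (4 / rho')) (12 * C * (2 / alpha) * X * ln (4 / rho)).
move: (6 * C / alpha ^+ 2 * K * X * (5 - rho')) (6 * C / alpha ^+ 2 * K * X * (5 - rho)).
move: (C * K * X / alpha) (C * X) (C * y') => a1 a2 a3 a4 a5 a6 a7; lra.
Qed.

Lemma time_potential_cross y y' rho rho' : 0 < rho -> rho < 2 -> rho' <= 2 * rho ->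
  y' <= 6 * X + 2 * K / alpha * rho' * X ->
  2 * C * y' <= time_potential y rho.
Proof.
move=> r0 r2 rr yb.
apply: le_trans (time_potential_low y r0 r2).
have yb' : 2 * C * y' <= 2 * C * (6 * X + 2 * K / alpha * rho' * X).
  by rewrite ler_wpM2l // mulr_ge0 // ltW.
apply: le_trans yb' _.
have -> : 2 * C * (6 * X + 2 * K / alpha * rho' * X) =
   12 * C * X + (C * K * X / alpha) * (4 * rho') by field; rewrite lt0r_neq0.
rewrite lerD2l.
have -> : 18 * C * K * X / alpha = (C * K * X / alpha) * 18 by field; rewrite lt0r_neq0.
apply: ler_wpM2l => //; lra.
Qed.

End RealInequalities.

(** * Error and running time of the main loop *)

Section Analysis.
Variables (R : realType) (alpha : R) (n : nat) (e : rel 'I_n) (A : adjacency e).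
Variables (W : nat) (t : 'I_n) (K : R).
Hypotheses (alpha01 : 0 < alpha < 1).
Hypotheses (n_gt0 : (0 < n)%N) (nW : (n < W)%N) (W_gt2 : (2 < W)%N).
Hypothesis K_gt0 : 0 < K.

Local Notation pi_t := (pagerank alpha e t).
Local Notation X := (max_min_cost alpha e t).

Let alpha_gt0 : 0 < alpha. Proof. by case/andP: alpha01. Qed.
Let alpha_lt1 : alpha < 1. Proof. by case/andP: alpha01. Qed.
Let pi_gt0 : 0 < pi_t. Proof. exact: pagerank_gt0. Qed.

Lemma max_min_cost_ge r : 0 <= r <= 1 ->
  Num.min (Tsum alpha e t r)%:R (r / pi_t) <= X.
Proof.
move=> r01; apply: ub_le_sup; last by exists r => //=; rewrite in_itv.
exists (1 / pi_t) => y [r' /=]; rewrite in_itv /= => /andP[_ r1] <-.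
by rewrite ge_min; apply/orP; right; rewrite ler_pM2r // invr_gt0.
Qed.

(** Taking [r = alpha / 2], at which [t] is still counted. A constant lower bound on [X] is what
    absorbs the set-up time of order log n. *)
Lemma max_min_cost_ge_half : alpha / 2 <= X.
Proof.
have h := @max_min_cost_ge (alpha / 2); have := alpha_lt1; have := alpha_gt0 => a0 a1.
apply: le_trans (h _); last by apply/andP; split; lra.
rewrite le_min; apply/andP; split.
  have := Tsum_gt0 e t alpha01 (lexx 1); rewrite /theta mulr1 => T0.
  apply: (@le_trans _ _ 1); first by lra.
  by rewrite ler1n.
by rewrite ler_pdivlMr // ler_piMr ?pagerank_le1 //; lra.
Qed.

Definition rho (N : nat) (M : R) : R := N%:R * pi_t / (K * M).

Lemma rho_gt0 N M : (0 < N)%N -> 0 < M -> 0 < rho N M.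
Proof. by move=> N0 M0; rewrite /rho divr_gt0 ?mulr_gt0 // ltr0n. Qed.

Lemma rho_next N M N' M' : next_params alpha N M N' M' -> (0 < N)%N -> 0 < M ->
  [/\ rho N M <= (1 - alpha / 2) * rho N' M', rho N' M' <= 2 * rho N M
    & N'%:R <= 2 * N%:R :> R].
Proof.
move=> nx N0 M0; have r0 := rho_gt0 N0 M0; have := alpha_lt1; have := alpha_gt0 => a0 a1.
have q0 : 1 - alpha / 2 != 0 by apply: lt0r_neq0; lra.
have n0 : 0 <= N%:R :> R by [].
case: nx => -[-> ->].
  have e1 : (1 - alpha / 2) * rho N ((1 - alpha / 2) * M) = rho N M.
    by rewrite /rho; move: q0; set q := 1 - alpha / 2 => q0; field; rewrite q0 !lt0r_neq0.
  have h : 0 < rho N ((1 - alpha / 2) * M).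
    by rewrite rho_gt0 // mulr_gt0 //; lra.
  split; [by rewrite e1| |lra].
  by rewrite -e1; have := mulr_ge0 (ltW (_ : 0 < 1 - alpha)) (ltW h); rewrite subr_gt0 => /(_ a1); lra.
have e2 : rho (2 * N) M = 2 * rho N M by rewrite /rho natrM; ring.
rewrite e2 natrM; split => //.
have := mulr_ge0 (ltW (_ : 0 < 1 - alpha)) (ltW r0); rewrite subr_gt0 => /(_ a1); lra.
Qed.

(** At [r = theta] the minimum is one of two terms: if it is [T_r], the doubling rule bounds [N]; if
    it is [r / pi], then [N = (2 K / alpha) rho (theta / pi)] does. *)
Lemma budget_le N M : 0 < M <= 1 -> (N <= 6 * Tsum alpha e t (theta alpha M))%N ->
  N%:R <= 6 * X + 2 * K / alpha * rho N M * X.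
Proof.
case/andP=> M0 M1 NT; have X0 : 0 <= X.
  by apply: le_trans max_min_cost_ge_half; rewrite divr_ge0 // ltW.
have th0 : 0 <= theta alpha M by rewrite /theta divr_ge0 // mulr_ge0 // ltW.
have th1 : theta alpha M <= 1.
  have : alpha * M <= 1 by rewrite mulr_ile1 // ltW.
  by rewrite /theta; lra.
have := max_min_cost_ge (r := theta alpha M); rewrite th0 th1 => /(_ isT).
have c0 : 0 <= 2 * K / alpha * rho N M.
  apply: mulr_ge0; first by rewrite divr_ge0 ?(ltW alpha_gt0) // mulr_ge0 // ltW.
  by apply: divr_ge0; apply: mulr_ge0; rewrite ?ler0n // ltW.
rewrite ge_min => /orP[TX|tX].
  have : (N%:R : R) <= 6 * X.
    by apply: le_trans (ler_wpM2l _ TX); rewrite // -natrM ler_nat.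
  by have := mulr_ge0 c0 X0; lra.
have -> : N%:R = 2 * K / alpha * rho N M * (theta alpha M / pi_t).
  by rewrite /rho /theta; field; rewrite !lt0r_neq0.
have := ler_wpM2l c0 tX; lra.
Qed.

Section Error.
Variable eps : R.
Hypothesis eps01 : 0 < eps <= 1.

Let bad (z : R) : R := (~~ ((1 - eps) * pi_t <= z <= (1 + eps) * pi_t))%:R.

Lemma value_error m s N M : loop_inv alpha e t s K N M ->
  value A W 0 bad m ([:: main_loop], s) <=
  16 / (alpha ^+ 2 * K * eps ^+ 2) * (2 / (1 + rho N M)).
Proof.
have e0 : 0 < eps by case/andP: eps01.
have bad0 z : 0 <= bad z by [].
set E0 := 16 / _; have E00 : 0 < E0.
  by rewrite divr_gt0 // mulr_gt0 ?exprn_gt0 // mulr_gt0 // exprn_gt0.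
elim: m s N M => [|m IH] s N M inv.
  have [L [x [p [_ _ _ [N0 _ /andP[M0 _]]]]]] := inv.
  by rewrite /= mulr_ge0 ?(ltW E00) // divr_ge0 // addr_ge0 // ltW // rho_gt0.
have [L [x [p [_ _ _ [N0 _ /andP[M0 _]]]]]] := inv.
have [N' [M' [nx N'0 M'01 _ step]]] :=
  value_main A alpha01 (lexx 0) bad0 n_gt0 nW W_gt2 m inv.
have M'0 : 0 < M' by case/andP: M'01.
have [r1 _ _] := rho_next nx N0 M0.
have r0 := rho_gt0 N0 M0; have r'0 := rho_gt0 N'0 M'0.
set u := K * M'; set w := N'%:R * pi_t.
have u0 : 0 < u by rewrite mulr_gt0.
have w0 : 0 < w by rewrite mulr_gt0 // ltr0n.
have Bnd0 : 0 <= E0 * (2 / (1 + rho N' M')).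
  by rewrite mulr_ge0 ?(ltW E00) // divr_ge0 // addr_ge0 // ltW.
have c20 : 0 <= 16 / (eps * (u + w)) ^+ 2 by rewrite divr_ge0 // sqr_ge0.
set Bnd := E0 * (2 / (1 + rho N' M')) in Bnd0 *.
(* Continuing is charged [Bnd] for every [z], so the quadratic part only has to dominate the
   indicator of a bad halt. *)
apply: le_trans (step Bnd Bnd _ c20 (fun s' => IH s' N' M') _) _.
- move=> z; rewrite -/w -/u.
  have q0 : 0 <= 16 / (eps * (u + w)) ^+ 2 * (z - w) ^+ 2.
    by rewrite mulr_ge0 // sqr_ge0.
  case: ifP => uz; last by rewrite lerDl.
  have n'0 : 0 < N'%:R :> R by rewrite ltr0n.
  have -> : bad (z / N'%:R) = (~~ ((1 - eps) * w <= z <= (1 + eps) * w))%:R.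
    rewrite /bad ler_pdivlMr // ler_pdivrMr // /w.
    by rewrite -!mulrA ![pi_t * _]mulrC.
  case: (boolP (_ <= z <= _)) => /= out; first by rewrite addr_ge0.
  have := outlier_deviation eps01 u0 w0 uz out; lra.
rewrite mul0r add0r.
have -> : 16 / (eps * (u + w)) ^+ 2 * (N'%:R * (M' / alpha * pi_t)) =
   E0 * (alpha * rho N' M' / (1 + rho N' M') ^+ 2).
  have -> : N'%:R * (M' / alpha * pi_t) = w * M' / alpha by rewrite /w; field; rewrite lt0r_neq0.
  have -> : rho N' M' = w / u by [].
  rewrite /E0 /u in u0 *; field.
  rewrite !lt0r_neq0 // ?addr_gt0 //.
rewrite -mulrDr; apply: ler_wpM2l; first exact: ltW.
exact: error_potential_step.
Qed.

End Error.

Hypothesis aK : 8 <= alpha * K.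

Lemma value_time_main m s N M : loop_inv alpha e t s K N M ->
  value A W 1 (fun=> 0) m ([:: main_loop], s) <=
  time_potential alpha X K (69 + 10 / alpha) N%:R (rho N M).
Proof.
set C := 69 + 10 / alpha; have C0 : 0 < C by rewrite addr_gt0 // divr_gt0.
have X0 : 0 <= X.
  by apply: le_trans max_min_cost_ge_half; rewrite divr_ge0 // ltW.
elim: m s N M => [|m IH] s N M inv.
  have [L [x [p [_ _ _ [N0 _ /andP[M0 _]]]]]] := inv.
  by apply: time_potential_ge0 => //; exact: rho_gt0.
have [L [x [p [_ _ _ [N0 _ /andP[M0 _]]]]]] := inv.
have [N' [M' [nx N'0 M'01 N'T step]]] :=
  value_main A alpha01 ler01 (fun=> lexx 0) n_gt0 nW W_gt2 m inv.
have M'0 : 0 < M' by case/andP: M'01.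
have [r1 r2 n2] := rho_next nx N0 M0.
have r0 := rho_gt0 N0 M0; have r'0 := rho_gt0 N'0 M'0.
have yb := budget_le M'01 N'T.
have n'0 : 0 < N'%:R :> R by rewrite ltr0n.
set Bnd := time_potential alpha X K C N'%:R (rho N' M').
have Bnd0 : 0 <= Bnd by apply: time_potential_ge0 => //; exact: ltW.
case: (ltrP (rho N' M') 2) => r'2.
  apply: le_trans (step Bnd Bnd 0 (lexx 0) (fun s' => IH s' N' M') _) _.
    by move=> z; rewrite mul0r addr0; case: ifP.
  rewrite mul1r mul0r addr0; apply: time_potential_step => //.
set w := N'%:R * pi_t.
have w0 : 0 < w by rewrite mulr_gt0.
have uw : 2 * (K * M') <= w by move: r'2; rewrite /rho ler_pdivlMr // mulr_gt0.
have c20 : 0 <= Bnd * (4 / w ^+ 2) by rewrite mulr_ge0 // divr_ge0 // sqr_ge0.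
(* Now [rho' >= 2], so not halting means [z < K M' <= w / 2], a deviation of at least [w / 2]. *)
apply: le_trans (step Bnd 0 (Bnd * (4 / w ^+ 2)) c20 (fun s' => IH s' N' M') _) _.
  move=> z; rewrite add0r -/w; case: ifPn => [_|]; first by rewrite mulr_ge0 // sqr_ge0.
  rewrite -ltNge => zu; rewrite -[leLHS]mulr1 -mulrA ler_wpM2l //.
  rewrite mulrAC ler_pdivlMr ?exprn_gt0 // mul1r.
  have : (w / 2) ^+ 2 <= (w - z) ^+ 2 by rewrite lerXn2r // ?nnegrE; lra.
  rewrite -(sqrrN (z - w)) opprB; lra.
rewrite mul1r addr0.
have BE : Bnd = 4 * C * N'%:R by rewrite /Bnd /time_potential r'2.
(* The probability of not halting is at most [2 / (alpha K) <= 1 / 4]. The budget at most doubles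
   per round, so the expected cost of the later rounds halves. *)
have fail : Bnd * (4 / w ^+ 2) * (N'%:R * (M' / alpha * pi_t)) <= C * N'%:R.
  have -> : Bnd * (4 / w ^+ 2) * (N'%:R * (M' / alpha * pi_t)) =
    C * N'%:R * (16 * M' / (alpha * w)).
    by rewrite BE /w; field; rewrite !lt0r_neq0.
  rewrite -[leRHS]mulr1; apply: ler_wpM2l; first by rewrite mulr_ge0 // ltW.
  rewrite ler_pdivrMr ?mulr_gt0 // mul1r.
  have h1 := ler_wpM2l (ltW alpha_gt0) uw.
  have h2 := ler_wpM2r (ltW M'0) aK.
  lra.
have tot : C * N'%:R + Bnd * (4 / w ^+ 2) * (N'%:R * (M' / alpha * pi_t)) <= 2 * C * N'%:R by lra.
apply: le_trans tot _.
case: (ltrP (rho N M) 2) => r22.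
  by apply: time_potential_cross r2 yb.
rewrite /time_potential r22.
have := ler_wpM2l (ltW C0) n2; lra.
Qed.

End Analysis.

(** * Logarithmic factors and the choice of constants *)

Section Logarithms.
Variables (R : realType) (n : nat).
Hypothesis n_gt1 : (1 < n)%N.

Let ln2_gt0 : 0 < ln 2 :> R. Proof. by rewrite ln_gt0 // ltr1n. Qed.
Let n_gt0 : 0 < n%:R :> R. Proof. by rewrite ltr0n ltnW. Qed.

Lemma log2_ge1 : 1 <= log2 R n.
Proof. by rewrite /log2 ler_pdivlMr // mul1r ler_ln ?posrE // ler_nat. Qed.

Lemma log2_le_trunc_log : log2 R n <= (trunc_log 2 n).+1%:R.
Proof.
have p k : 0 < (2 ^ k)%:R :> R by rewrite ltr0n expn_gt0.
rewrite /log2 ler_pdivrMr // mulr_natl -lnXn // -natrX ler_ln ?posrE ?p //.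
by rewrite ler_nat ltnW // trunc_log_ltn.
Qed.

Lemma trunc_log_le_log2 : (trunc_log 2 n)%:R <= log2 R n.
Proof.
have p k : 0 < (2 ^ k)%:R :> R by rewrite ltr0n expn_gt0.
rewrite /log2 ler_pdivlMr // mulr_natl -lnXn // -natrX ler_ln ?posrE ?p //.
by rewrite ler_nat trunc_logP // ltnW.
Qed.

Lemma ln_le_log2 : ln n%:R <= log2 R n.
Proof.
have -> : ln n%:R = log2 R n * ln 2 by rewrite /log2 divfK // lt0r_neq0.
have : ln 2 <= 1 :> R by have := @le_ln1Dx R 1; have -> : 1 + 1 = 2 :> R by []; apply; lra.
by move=> h; rewrite ler_piMr // (le_trans ler01 log2_ge1).
Qed.

Lemma accuracy_bounds : 0 < accuracy R n <= 1.
Proof.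
have y1 : 1 <= log2 R n `^ 4^-1.
  by rewrite -[leLHS](powRr0 (log2 R n)); apply: ler_powR; [exact: log2_ge1|rewrite invr_ge0].
by rewrite /accuracy invr_gt0 (lt_le_trans ltr01 y1) invf_le1 // (lt_le_trans ltr01 y1).
Qed.

(** With [y] the fourth root of the logarithm, the left side is [y ^- 2] and the right side
    [y ^- 1]. *)
Lemma accuracy_absorbs : (log2 R n * accuracy R n ^+ 2)^-1 <= accuracy R n.
Proof.
have y1 : 1 <= log2 R n `^ 4^-1.
  by rewrite -[leLHS](powRr0 (log2 R n)); apply: ler_powR; [exact: log2_ge1|rewrite invr_ge0].
rewrite /accuracy; have l0 := le_trans ler01 log2_ge1.
have e4 : (log2 R n `^ 4^-1) ^+ 4 = log2 R n.
  by rewrite -powR_mulrn ?powR_ge0 // -powRrM mulVf ?powRr1 // pnatr_eq0.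
move: (log2 R n `^ 4^-1) y1 e4 => y y1 <-.
have y0 : 0 < y by exact: lt_le_trans y1.
have -> : (y ^+ 4 * y^-1 ^+ 2)^-1 = y^-1 * y^-1 by field; rewrite lt0r_neq0.
by rewrite ler_piMl ?invr_ge0 ?(ltW y0) // invf_le1.
Qed.

End Logarithms.

(** The logarithm [lam] occurs once in each of three terms: the set-up time, the number of rounds
    through [ln (4 / r)], and the scale [K = c * l]. *)
Lemma ler_total_time (R : realType) (alpha C c lam l X r : R) :
  0 < alpha < 1 -> 0 < C -> 0 < c -> 1 <= lam -> l <= 2 * lam -> 0 <= l ->
  alpha / 2 <= X -> 0 < r -> r < 2 -> ln (4 / r) <= (ln (4 * c / alpha) + 2) * lam ->
  40 * l + time_potential alpha X (c * l) C 1 r <=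
  (160 / alpha + 24 * C / alpha * (ln (4 * c / alpha) + 2) + 60 * C * c / alpha ^+ 2)
    * (lam * X).
Proof.
case/andP=> a0 a1 C0 c0 lam1 ll l0 aX r0 r2 hln.
have X0 : 0 <= X by apply: le_trans aX; rewrite divr_ge0 // ltW.
rewrite /time_potential (lt_geF r2).
have -> : (160 / alpha + 24 * C / alpha * (ln (4 * c / alpha) + 2) + 60 * C * c / alpha ^+ 2)
    * (lam * X) = 160 / alpha * (lam * X) +
    (24 * C / alpha * (ln (4 * c / alpha) + 2) * (lam * X) + 60 * C * c / alpha ^+ 2 * (lam * X)).
  by ring.
apply: lerD; last first.
  apply: lerD.
    have -> : 24 * C / alpha * (ln (4 * c / alpha) + 2) * (lam * X)
      = 24 * C / alpha * X * ((ln (4 * c / alpha) + 2) * lam) by ring.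
    have -> : 12 * C * (2 / alpha) * X * ln (4 / r) = 24 * C / alpha * X * ln (4 / r).
      by field; rewrite lt0r_neq0.
    apply: ler_wpM2l => //.
    by rewrite mulr_ge0 // divr_ge0 ?ltW // mulr_gt0.
  have -> : 6 * C / alpha ^+ 2 * (c * l) * X * (5 - r) =
     6 * C * c / alpha ^+ 2 * X * (l * (5 - r)) by ring.
  have -> : 60 * C * c / alpha ^+ 2 * (lam * X) =
     6 * C * c / alpha ^+ 2 * X * (10 * lam) by field; rewrite lt0r_neq0.
  apply: ler_wpM2l.
    by rewrite mulr_ge0 // divr_ge0 ?sqr_ge0 // mulr_ge0 ?ltW // mulr_gt0.
  have := mulr_ge0 l0 (ltW r0); lra.
have -> : 160 / alpha * (lam * X) = 160 / alpha * lam * X by ring.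
apply: le_trans (_ : 160 / alpha * lam * (alpha / 2) <= _).
  have -> : 160 / alpha * lam * (alpha / 2) = 80 * lam by field; rewrite lt0r_neq0.
  lra.
apply: ler_wpM2l => //.
by rewrite mulr_ge0 ?divr_ge0 ?ltW // (lt_le_trans ltr01).
Qed.

Theorem theorem3p1 (R : realType) (alpha : R) (halpha : 0 < alpha < 1) :
  exists (P : cmd) (kappa : nat) (C : R) (n0 : nat),
    [/\ (0 < kappa)%N, 0 < C &
      forall (n : nat) (e : rel 'I_n) (A : adjacency e) (t : 'I_n),
        (1 < n)%N ->
        ((1 - accuracy R n)%:E <=
          output_prob alpha A kappa P t
            (fun x : R =>
               (1 - accuracy R n) * pagerank alpha e t <= x
                 <= (1 + accuracy R n) * pagerank alpha e t)%R)%E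
        /\
        ((n0 <= n)%N ->
          (expected_time alpha A kappa P t <=
            (C * (log2 R n * max_min_cost alpha e t))%:E)%E)].
Proof.
have /andP[a0 a1] := halpha.
(* The error bound is [32 / (alpha ^+ 2 * K * eps ^+ 2)]; this [c] brings it below
   [1 / (log2 n * eps ^+ 2)] and also gives [8 <= alpha * K]. *)
pose c := (Num.truncn (32 / alpha ^+ 2)).+1.
have cE : 32 / alpha ^+ 2 <= c%:R by apply/ltW; exact: truncnS_gt.
have c0 : 0 < c%:R :> R by rewrite ltr0n.
have a2 : alpha ^+ 2 <= alpha by rewrite expr2 ler_piMl // ltW.
have ca : 32 <= alpha * c%:R.
  have := ler_wpM2l (ltW a0) cE.
  have -> : alpha * (32 / alpha ^+ 2) = 32 / alpha by field; rewrite lt0r_neq0.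
  apply: le_trans; rewrite ler_pdivlMr //; lra.
pose C0 := 69 + 10 / alpha; have C00 : 0 < C0 by rewrite addr_gt0 // divr_gt0.
have lc0 : 0 <= ln (4 * c%:R / alpha).
  apply: ln_ge0; rewrite ler_pdivlMr // mul1r.
  have : (1 : R) <= c%:R by rewrite ler1n.
  lra.
exists (program c), c.+2,
  (160 / alpha + 24 * C0 / alpha * (ln (4 * c%:R / alpha) + 2) + 60 * C0 * c%:R / alpha ^+ 2), 0%N.
split => //.
  rewrite addr_gt0 ?divr_gt0 ?mulr_gt0 ?exprn_gt0 // addr_gt0 ?divr_gt0 //.
  by rewrite mulr_gt0 ?divr_gt0 ?mulr_gt0 // ltr_wpDl.
move=> n e A t n1; have n0 : (0 < n)%N by exact: ltnW.
set W := word_bound n c.+2.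
have nW : (n < W)%N by rewrite /W /word_bound -{1}(expn1 n.+1) leq_exp2l.
(* The word size exponent is [c.+2] so that the literal [c] in the program is not reduced modulo
   [W], whatever [n] is. *)
have cW : (c.+2 < W)%N by apply: ltn_expl; rewrite ltnS.
have W2 : (2 < W)%N by apply: leq_ltn_trans cW.
have cW' : (c < W)%N by apply: leq_ltn_trans cW; rewrite leqW.
set l := (trunc_log 2 n).+1; set K : R := (c * l)%:R.
have l1 : (1 : R) <= l%:R by rewrite ler1n.
have KE : K = c%:R * l%:R by rewrite /K natrM.
have cK : c%:R <= K by rewrite KE ler_peMr // ltW.
have K0 : 0 < K by exact: lt_le_trans cK.
have aK : 8 <= alpha * K.
  by apply: le_trans (ler_wpM2l (ltW a0) cK); lra.
have lam1 := @log2_ge1 R _ n1.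
have lam_l := @log2_le_trunc_log R _ n1; rewrite -/l in lam_l.
have l_lam := @trunc_log_le_log2 R _ n1.
have l2 : l%:R <= 2 * log2 R n by rewrite /l -natr1; lra.
have eps01 := @accuracy_bounds R _ n1; have /andP[e0 e1] := eps01.
have p0 := pagerank_gt0 e halpha t.
have p1 := pagerank_le1 e halpha t.
have pn := pagerank_ge e halpha t.
have r0 : 0 < rho alpha e t K 1 1 by exact: rho_gt0.
have r2 : rho alpha e t K 1 1 < 2.
  rewrite /rho mulr1 mul1r ltr_pdivrMr //.
  have : (32 : R) <= c%:R by apply: le_trans ca _; rewrite ler_piMl // ltW.
  lra.
have [h1 h2] : ((1 - accuracy R n)%:E <= output_prob alpha A c.+2 (program c) t
    (fun x : R => ((1 - accuracy R n) * pagerank alpha e t <= x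
                 <= (1 + accuracy R n) * pagerank alpha e t)%R))%E /\
   (expected_time alpha A c.+2 (program c) t <=
    (40 * l%:R + time_potential alpha (max_min_cost alpha e t) K C0 1 (rho alpha e t K 1 1))%:E)%E.
  apply: outcome_bounds => // m.
    have [s inv h] := value_program A t halpha ler01 (fun=> lexx (0 : R)) n0 nW W2 cW'.
    apply: le_trans (h m) _; rewrite mul1r natrM lerD2l.
    exact: (value_time_main A halpha n0 nW W2 K0 aK m inv).
  have [s inv h] := value_program A t halpha (lexx 0)
    (g := fun x => (~~ ((1 - accuracy R n) * pagerank alpha e t <= x
                 <= (1 + accuracy R n) * pagerank alpha e t))%:R) (fun=> ler0n _ _) n0 nW W2 cW'.
  apply: le_trans (h m) _; rewrite mul0r add0r.
  apply: le_trans (value_error A halpha n0 nW W2 K0 eps01 m inv) _.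
  apply: le_trans (accuracy_absorbs R n1).
  have lam0 : 0 < log2 R n by exact: lt_le_trans lam1.
  apply: (@le_trans _ _ (32 / (alpha ^+ 2 * K * accuracy R n ^+ 2))).
    have -> : 32 / (alpha ^+ 2 * K * accuracy R n ^+ 2) =
      16 / (alpha ^+ 2 * K * accuracy R n ^+ 2) * 2 by ring.
    apply: ler_wpM2l; first by rewrite divr_ge0 // mulr_ge0 ?sqr_ge0 // mulr_ge0 ?sqr_ge0 // ltW.
    by rewrite ler_pdivrMr ?addr_gt0 //; lra.
  have -> : 32 / (alpha ^+ 2 * K * accuracy R n ^+ 2) =
     (alpha ^+ 2 / 32 * K * accuracy R n ^+ 2)^-1.
    by field; rewrite !lt0r_neq0.
  have q0 : 0 < accuracy R n ^+ 2 by rewrite exprn_gt0.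
  have q1 : 0 < alpha ^+ 2 / 32 by rewrite divr_gt0 // exprn_gt0.
  rewrite lef_pV2 ?posrE; [|by do 2 apply: mulr_gt0|exact: mulr_gt0].
  rewrite ler_wpM2r ?sqr_ge0 // KE mulrA.
  apply: le_trans lam_l _; rewrite ler_peMl //.
  by rewrite mulrAC ler_pdivlMr // mul1r -ler_pdivrMl ?exprn_gt0 // mulrC.
split => // _; apply: le_trans h2 _; rewrite lee_fin KE.
have rE : rho alpha e t K 1 1 = rho alpha e t (c%:R * l%:R) 1 1 by rewrite KE.
rewrite -rE; apply: ler_total_time => //; first by exact: max_min_cost_ge_half.
have nR0 : 0 < n%:R :> R by rewrite ltr0n.
(* Initially [rho = pi / K] with [pi >= alpha / n] and [K <= c * n], so the number of rounds,
   logarithmic in [1 / rho], is of order log n. *)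
have b1 : 4 / rho alpha e t K 1 1 <= 4 * c%:R / alpha * n%:R ^+ 2.
  have -> : 4 / rho alpha e t K 1 1 = 4 * K / pagerank alpha e t.
    by rewrite /rho; field; rewrite !lt0r_neq0.
  have ln : l%:R <= n%:R :> R.
    by rewrite ler_nat /l; apply: leq_trans (ltn_expl _ (ltnSn 1)) _; rewrite trunc_logP.
  rewrite ler_pdivrMr //.
  apply: (@le_trans _ _ (4 * c%:R / alpha * n%:R ^+ 2 * (alpha / n%:R))).
    have -> : 4 * c%:R / alpha * n%:R ^+ 2 * (alpha / n%:R) = 4 * (c%:R * n%:R).
      by field; rewrite !lt0r_neq0.
    by rewrite KE; apply: ler_wpM2l => //; apply: ler_wpM2l => //; exact: ltW.
  by apply: ler_wpM2l => //; rewrite mulr_ge0 ?sqr_ge0 // divr_ge0 ?ltW // mulr_gt0.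
have b2 : ln (4 / rho alpha e t K 1 1) <= ln (4 * c%:R / alpha * n%:R ^+ 2).
  by rewrite ler_ln ?posrE ?mulr_gt0 ?invr_gt0 ?exprn_gt0.
apply: le_trans b2 _.
have c1 : 0 < 4 * c%:R / alpha by rewrite divr_gt0 // mulr_gt0.
have -> : ln (4 * c%:R / alpha * n%:R ^+ 2) = ln (4 * c%:R / alpha) + ln n%:R *+ 2.
  by rewrite -lnXn // -lnM // posrE exprn_gt0.
have := @ln_le_log2 R _ n1.
have := ler_wpM2l lc0 lam1.
rewrite mulr2n; move: (ln (4 * c%:R / alpha)) => y; lra.
Qed.
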